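(* Fix $k\ge 2$ and $p\ge 1$. Let $H=\langle w_1,\dots,w_p\rangle\subset \mathbb{F}_k$ be the subgroup generated by $p$ independent simple random walks $w_1,\dots,w_p$ of length $n$ on $\mathbb{F}_k$. With probability going to $1$ exponentially fast as $n\to+\infty$, the subgroup $H$ is $\mathrm{Aut}$-malnormal in $\mathbb{F}_k$. In particular, $\mathrm{Aut}(\mathbb{F}_k,H)=\mathrm{Inn}_H(\mathbb{F}_k)$.
   Context: $\mathbb{F}_k$ is the free group of rank $k$ with a fixed free basis $X$. A simple random walk of length $n$ is $w=s_1\cdots s_n$ with $s_1,\dots,s_n$ chosen independently and uniformly in $X^{\pm1}=X\cup X^{-1}$. For a subgroup $H$ of a group $G$: $\mathrm{Aut}(G,H)$ is the group of automorphisms of $G$ leaving $H$ invariant; $\mathrm{Inn}_H(G)$ is the group of conjugations $g\mapsto hgh^{-1}$ of $G$ with $h\in H$; $H$ is $\mathrm{Aut}$-malnormal if any $\alpha\in\mathrm{Aut}(G)$ such that $\alpha(H)\cap H\ne\{1\}$ belongs to $\mathrm{Inn}_H(G)$. An event (depending on $n$) occurs with probability going to $1$ exponentially fast as $n\to+\infty$ if the probability that it does not occur is bounded by $C\kappa^{-n}$ for some constants $C>0$ and $\kappa>1$. *)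

(* Defs.v *)
From HB Require Import structures.
From mathcomp Require Import all_boot all_order all_algebra.
From mathcomp Require Import all_classical all_reals.

Set Implicit Arguments.
Unset Strict Implicit.
Unset Printing Implicit Defensive.

Import Order.TTheory GRing.Theory Num.Theory.

Local Open Scope classical_set_scope.
Local Open Scope group_scope.

(* The letter (i, true) stands for the basis element x_i, and (i, false) for
   its inverse. *)
Definition letter (k : nat) : finType := ('I_k * bool)%type.

Definition letterV (k : nat) (a : letter k) : letter k := (a.1, ~~ a.2).

Definition reduced (k : nat) (w : seq (letter k)) : bool :=
  sorted (fun a b => b != letterV a) w.

Section Words.
Variable k : nat.
Implicit Types (a b : letter k) (u v w : seq (letter k)).

Definition push a w : seq (letter k) :=
  if w is b :: w' then if b == letterV a then w' else a :: w else [:: a].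

Definition word_mul u v : seq (letter k) := foldr push v u.

Definition word_inv w : seq (letter k) := rev (map (@letterV k) w).

Lemma letterVK : involutive (@letterV k).
Proof. by case=> i b; rewrite /letterV /= negbK. Qed.

Lemma letterV_neq a : letterV a != a.
Proof. by case: a => i []; rewrite /letterV /eq_op /= andbF. Qed.

Lemma reduced_cons a w : reduced (a :: w) -> reduced w.
Proof. by case: w => //= b w /andP[]. Qed.

Lemma reduced_push a w : reduced w -> reduced (push a w).
Proof.
case: w => //= b w rw; case: (altP (b =P letterV a)) => [_|nb].
  exact: (@reduced_cons b).
by rewrite /reduced /= nb.
Qed.

Lemma push_cons a w : reduced (a :: w) -> push a w = a :: w.
Proof. by case: w => //= b w /andP[/negbTE->]. Qed.

Lemma pushVK a w : reduced w -> push (letterV a) (push a w) = w.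
Proof.
case: w => [|b w] rw /=; first by rewrite letterVK eqxx.
case: (altP (b =P letterV a)) => [bE|nb].
  by rewrite -bE push_cons.
by rewrite /= letterVK eqxx.
Qed.

Lemma pushKV a w : reduced w -> push a (push (letterV a) w) = w.
Proof. by move=> rw; rewrite -{1}[a]letterVK pushVK. Qed.

Lemma reduced_mul u v : reduced v -> reduced (word_mul u v).
Proof. by move=> rv; elim: u => //= a u; apply: reduced_push. Qed.

Lemma word_mul_push a u w :
  reduced w -> word_mul (push a u) w = push a (word_mul u w).
Proof.
move=> rw; case: u => [//|b u] /=.
case: (altP (b =P letterV a)) => [->|//].
by rewrite pushKV //; apply: reduced_mul.
Qed.

Lemma word_mulA u v w : reduced w ->
  word_mul u (word_mul v w) = word_mul (word_mul u v) w.
Proof.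
by move=> rw; elim: u => //= a u IHu; rewrite word_mul_push // IHu.
Qed.

Lemma word_mul1 u : reduced u -> word_mul u [::] = u.
Proof.
elim: u => //= a u IHu ru.
by rewrite IHu ?push_cons //; apply: reduced_cons ru.
Qed.

Lemma word_mul_cat u v w : word_mul (u ++ v) w = word_mul u (word_mul v w).
Proof. by rewrite /word_mul foldr_cat. Qed.

Lemma reduced_inv w : reduced w -> reduced (word_inv w).
Proof.
rewrite /reduced /word_inv rev_sorted; case: w => //= a w.
rewrite path_map; apply: sub_path => b c /= cb.
by rewrite letterVK eq_sym.
Qed.

Lemma word_mulV w v : reduced v -> word_mul (word_inv w) (word_mul w v) = v.
Proof.
elim: w v => //= a w IHw v rv.
rewrite /word_inv /= rev_cons -cats1 word_mul_cat /= pushVK ?IHw //.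
exact: reduced_mul.
Qed.

Lemma word_invK : involutive word_inv.
Proof. by move=> w; rewrite /word_inv map_rev revK mapK //; apply: letterVK. Qed.

End Words.

Record free_group (k : nat) : Type := FreeGroup {
  fg_word : seq (letter k);
  fg_wordP : reduced fg_word
}.

HB.instance Definition _ (k : nat) := [isSub for @fg_word k].
HB.instance Definition _ (k : nat) := [Countable of free_group k by <:].

Section FreeGroupStructure.
Variable k : nat.
Implicit Types u v w : free_group k.

Definition fg_one : free_group k := @FreeGroup k [::] isT.
Definition fg_mul u v : free_group k :=
  FreeGroup (reduced_mul (fg_word u) (fg_wordP v)).
Definition fg_inv u : free_group k := FreeGroup (reduced_inv (fg_wordP u)).

Lemma fg_mulA : associative fg_mul.
Proof. by move=> u v w; apply: val_inj; apply/word_mulA/fg_wordP. Qed.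

Lemma fg_mul1 : left_id fg_one fg_mul.
Proof. by move=> u; apply: val_inj. Qed.

Lemma fg_mulr1 : right_id fg_one fg_mul.
Proof. by move=> u; apply: val_inj; apply/word_mul1/fg_wordP. Qed.

Lemma fg_mulV : left_inverse fg_one fg_inv fg_mul.
Proof.
move=> u; apply: val_inj => /=.
by rewrite -{2}[fg_word u]word_mul1 ?word_mulV //; apply: fg_wordP.
Qed.

Lemma fg_mulrV : right_inverse fg_one fg_inv fg_mul.
Proof.
move=> u; rewrite -{1}(_ : fg_inv (fg_inv u) = u) ?fg_mulV //.
by apply: val_inj; apply: word_invK.
Qed.

End FreeGroupStructure.

HB.instance Definition _ (k : nat) := isGroup.Build (free_group k)
  (@fg_mulA k) (@fg_mul1 k) (@fg_mulr1 k) (@fg_mulV k) (@fg_mulrV k).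

Definition fg_basis (k : nat) (i : 'I_k) : free_group k :=
  @FreeGroup k [:: (i, true)] isT.

Definition letter_eval (k : nat) (G : groupType) (x : 'I_k -> G)
    (a : letter k) : G :=
  if a.2 then x a.1 else (x a.1)^-1.

Definition word_eval (k : nat) (G : groupType) (x : 'I_k -> G)
    (w : seq (letter k)) : G :=
  \prod_(a <- w) letter_eval x a.

Lemma word_eval_basis (k : nat) (w : free_group k) :
  word_eval (@fg_basis k) (fg_word w) = w.
Proof.
case: w => w rw; rewrite /word_eval /=; apply: val_inj => /=.
elim: w rw => [|a w IHw] rw; first by rewrite big_nil.
rewrite big_cons; have -> (u v : free_group k) :
  fg_word (u * v) = word_mul (fg_word u) (fg_word v) by [].
rewrite IHw; last exact: reduced_cons rw.
have -> : fg_word (letter_eval (@fg_basis k) a) = [:: a].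
  by case: a {IHw rw} => i [].
exact: push_cons.
Qed.

Lemma free_group_universal (k : nat) (G : groupType) (x : 'I_k -> G) :
  exists! f : free_group k -> G,
    {morph f : u v / u * v} /\ (forall i, f (fg_basis i) = x i).
Proof.
pose e := word_eval x.
have eV a : letter_eval x (letterV a) = (letter_eval x a)^-1.
  by case: a => i []; rewrite /letter_eval //= invgK.
have eP a w : e (push a w) = letter_eval x a * e w.
  case: w => [|b w] /=; first by rewrite /e /word_eval big_seq1 big_nil mulg1.
  case: eqP => [->|_]; last by rewrite /e /word_eval big_cons.
  by rewrite /e /word_eval big_cons eV mulVKg.
have eM (u v : seq (letter k)) : e (word_mul u v) = e u * e v.
  elim: u => [|a u IHu] /=; first by rewrite {2}/e /word_eval big_nil mul1g.
  by rewrite eP IHu mulgA {3}/e /word_eval big_cons.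
exists (fun u => e (fg_word u)); split.
  split=> [u v|i]; first exact: eM.
  by rewrite /e /word_eval big_seq1.
move=> g [gM gx]; apply/funext => u.
have g1 : g 1 = 1 by apply: (mulgI (g 1)); rewrite -gM !mulg1.
have gV v : g v^-1 = (g v)^-1.
  by apply: (mulgI (g v)); rewrite -gM !mulgV g1.
rewrite -{2}(word_eval_basis u) /e /word_eval (big_morph g gM g1).
apply: eq_bigr => -[i b] _; rewrite /letter_eval /=.
by case: b; rewrite ?gV gx.
Qed.

Section Automorphisms.
Variable G : groupType.
Implicit Type H : set G.

Definition subgroup_gen (A : set G) : set G :=
  smallest (fun H : set G => group_closed [in H]) A.

Definition Automorphisms : set (G -> G) :=
  [set f | bijective f /\ {morph f : x y / x * y}].

Definition Aut_stab H : set (G -> G) :=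
  [set f | Automorphisms f /\ f @` H = H].

Definition Inn_by H : set (G -> G) :=
  [set f | exists2 h, H h & f = (fun g => h * g * h^-1)].

Definition Aut_malnormal H : Prop :=
  forall f, Automorphisms f -> (f @` H) `&` H <> [set 1] -> Inn_by H f.

End Automorphisms.

Definition walks (k p n : nat) : finType := {ffun 'I_p -> n.-tuple (letter k)}.

(* Product of the uniform laws of all the steps. *)
Definition walk_prob (R : realType) (k p n : nat) (E : set (walks k p n)) : R :=
  (\sum_(s : walks k p n | `[< E s >])
     \prod_(i < p) \prod_(j < n) #|letter k|%:R^-1)%R.

Lemma walk_prob_setT (R : realType) (k p n : nat) : (0 < k)%N ->
  walk_prob R (@setT (walks k p n)) = 1%R.
Proof.
move=> k0; rewrite /walk_prob.
rewrite (eq_bigl xpredT); last by move=> s; apply/asboolP.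
rewrite !sumr_const !prodr_const !card_ord -(mulr_natl _ #|_|).
rewrite card_ffun card_ord card_tuple !natrX !exprVn mulfV //.
rewrite !expf_neq0 // pnatr_eq0 card_prod card_ord card_bool.
by rewrite muln_eq0 negb_or -lt0n k0.
Qed.

Definition walk_subgroup (k p n : nat) (s : walks k p n) :
    set (free_group k) :=
  subgroup_gen [set word_eval (@fg_basis k) (s i) | i in [set: 'I_p]].

Definition exp_generic (R : realType) (k p : nat)
    (E : forall n, set (walks k p n)) : Prop :=
  exists C kappa : R, [/\ (0 < C)%R, (1 < kappa)%R &
    forall n, (walk_prob R (~` E n) <= C * kappa ^- n)%R].

(* Main.v *)
Require Import Defs.
From mathcomp Require Import all_boot all_order all_algebra.
From mathcomp Require Import all_classical all_reals.
From mathcomp Require Import perm zify lra.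

(** Let [q = 2 * k - 1] and [K = k * q]. There are [K] unordered pairs of distinct
    letters, called turns; a two-letter subword of a reduced word makes one of
    them, and in a long random reduced word each turn has frequency about
    [1 / K]. The proof has a deterministic part, valid for subgroups [H] whose
    generators look random, and a probabilistic part.

    Length of images. Let [f] be an automorphism and view the free group as the
    vertices of its Cayley tree. The number of letters [i] of [f g] is the number
    of translates of the segment from [1] to [g] which are cut by the preimage
    under [f] of the half-tree of words starting with [i]. Such a preimage [B] has
    a finite coboundary, and [cut_dichotomyP] bounds the number of cuts from below
    by looking at one or two vertices where the half-trees around are
    monochromatic for [B] without all having the same colour. If every turn occurs
    at least [m] times in [g], then, up to a constant, [B] contributes at least
    [q * m], and even [2 * (q - 1) * m] unless [B] is itself a half-tree up to a
    finite set. If some [B] is not a half-tree, [f g] has therefore about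
    [(K + 1) * m] letters at least ([length_gain]), to be compared with the [K * m]
    turns of [g]. If all of them are half-trees, they are disjoint and cover almost
    everything, which forces them to be the half-trees around one vertex; then the
    inverse of [f] permutes the letters, up to conjugation
    ([simple_aut_of_half_trees]).

    Small cancellation. Suppose that no long word occurs twice in the generators of
    [H] and their inverses, even up to a signed permutation of the letters, and that
    turns are balanced in the generators. Reduced products of generators keep most
    of each factor, so that turns are balanced in all elements of [H]. Assume that
    [x] and [f x] are nontrivial elements of [H]. If neither [f] nor its inverse is
    simple, both multiply the lengths of long balanced words by a factor larger
    than [1]; this is contradictory for the powers of [x] and of [f x]. If [f], say,
    is a signed permutation followed by the conjugation by [t], the words of [f u]
    and of [u], for [u] a power of [x], have a long common part up to the
    permutation. Hence the permutation is trivial, and comparing the vertices at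
    which the same occurrence is read gives [t] in [H]
    ([gen_subgroup_malnormal]).

    Probability. Supersolutions of the recurrence for the transition probabilities
    ([hits_le]) show that the random walk is exponentially unlikely to be short, and
    that it ends at a given word of length [l] with probability at most
    [1 / q ^ l], whereas there are about [q ^ l] such words. It remains to count
    reduced words. Each type of repetition determines many letters from the other
    ones, or restricts them, at the cost of a factor [(q - 1) / q] per letter
    ([constrained_words_le]); unbalanced turns are exponentially rare by an
    exponential moment estimate with an explicit approximate eigenvector
    ([turn_moment]). A union bound over positions concludes
    ([good_walks_generic]). The subgroup is then nontrivial, so that malnormality
    determines its stabilizer. *)

Set Implicit Arguments.
Unset Strict Implicit.
Unset Printing Implicit Defensive.

Import Order.TTheory GRing.Theory Num.Theory.

(** * Reduced words and elements of the free group *)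

Section FreeWords.
Variable k : nat.
Implicit Types (a b c : letter k) (u v w x y z : seq (letter k)).
Implicit Types g h : free_group k.
Local Open Scope group_scope.

Definition ev w : free_group k := word_eval (@fg_basis k) w.

Definition flen g := size (fg_word g).

Lemma ev_fg_word g : ev (fg_word g) = g.
Proof. exact: word_eval_basis. Qed.

Lemma ev_nil : ev [::] = 1.
Proof. by rewrite /ev /word_eval big_nil. Qed.

Lemma ev_cat u v : ev (u ++ v) = ev u * ev v.
Proof. by rewrite /ev /word_eval big_cat. Qed.

Lemma ev_cons a u : ev (a :: u) = ev [:: a] * ev u.
Proof. by rewrite -cat1s ev_cat. Qed.

Lemma ev_rcons u a : ev (rcons u a) = ev u * ev [:: a].
Proof. by rewrite -cats1 ev_cat. Qed.

Lemma fg_word_ev w : reduced w -> fg_word (ev w) = w.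
Proof. by move=> rw; rewrite (ev_fg_word (FreeGroup rw)). Qed.

Lemma ev_letterV a : ev [:: letterV a] = (ev [:: a])^-1.
Proof.
rewrite /ev /word_eval !big_seq1; case: a => i [] //=.
by rewrite /letter_eval /= invgK.
Qed.

Lemma word_inv_cat u v : word_inv (u ++ v) = word_inv v ++ word_inv u.
Proof. by rewrite /word_inv map_cat rev_cat. Qed.

Lemma word_inv_cons a u : word_inv (a :: u) = rcons (word_inv u) (letterV a).
Proof. by rewrite /word_inv /= rev_cons. Qed.

Lemma word_inv_rcons u a : word_inv (rcons u a) = letterV a :: word_inv u.
Proof. by rewrite /word_inv map_rcons rev_rcons. Qed.

Lemma size_word_inv u : size (word_inv u) = size u.
Proof. by rewrite /word_inv size_rev size_map. Qed.

Lemma ev_word_inv w : ev (word_inv w) = (ev w)^-1.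
Proof.
elim: w => [|a w IHw]; first by rewrite /word_inv /= ev_nil invg1.
by rewrite word_inv_cons ev_rcons IHw ev_letterV (ev_cons a w) invgM.
Qed.

Lemma fg_wordM g h : fg_word (g * h) = word_mul (fg_word g) (fg_word h).
Proof. by []. Qed.

Lemma fg_wordV g : fg_word g^-1 = word_inv (fg_word g).
Proof. by []. Qed.

Lemma fg_word_walk w : fg_word (ev w) = word_mul w [::].
Proof.
elim: w => [|a w IHw]; first by rewrite ev_nil.
by rewrite ev_cons fg_wordM fg_word_ev //= IHw.
Qed.

Lemma reduced_cat u v : reduced (u ++ v) -> reduced u /\ reduced v.
Proof.
rewrite /reduced; case: u => // a u; rewrite /= cat_path => /andP[-> h].
by split=> //; case: v h => //= b v /andP[].
Qed.

Lemma reduced_rcons u a b : reduced (rcons u a) -> b != letterV a ->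
  reduced (rcons (rcons u a) b).
Proof.
rewrite /reduced; case: u => [|c u] /=; first by move=> _ ->.
by rewrite !rcons_path => -> /=; rewrite last_rcons.
Qed.

Lemma reduced_rcons2 u a b : reduced (rcons (rcons u a) b) -> b != letterV a.
Proof.
rewrite /reduced; case: u => [|c u] /=; first by move=> /andP[].
by rewrite rcons_path last_rcons => /andP[].
Qed.

Lemma reduced_cat_cons u a b v : reduced (rcons u a) -> reduced (b :: v) ->
  b != letterV a -> reduced (rcons u a ++ b :: v).
Proof.
rewrite /reduced; case: u => [|c u] /=; first by move=> _ -> ->.
rewrite rcons_path cat_path /= rcons_path last_rcons => /andP[-> ->] -> ->.
by [].
Qed.

Lemma reduced_nseq a n : reduced (nseq n a).
Proof.
rewrite /reduced; case: n => //= n; elim: n => //= n ->.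
by rewrite eq_sym letterV_neq.
Qed.

Lemma letterV_eq a b : (letterV a == b) = (a == letterV b).
Proof. by rewrite -{2}[a](letterVK a) (inj_eq (can_inj (@letterVK k))). Qed.

(** The cancellation in a product of two reduced words is a single block [t]; all
    the estimates on products of reduced words below come from this. *)
Lemma word_mul_cancel u v : reduced u -> exists z1 t z2,
  [/\ u = z1 ++ word_inv t, v = t ++ z2 & word_mul u v = z1 ++ z2].
Proof.
elim: u => [|a u IHu] ru; first by exists [::], [::], v.
have [z1 [t [z2 [eu ev' em]]]] := IHu (reduced_cons ru).
rewrite /= em; case: z1 => [|c z1] in eu em *; last first.
  exists (a :: c :: z1), t, z2; split=> //=; first by rewrite eu.
  by move: ru; rewrite eu /reduced /= => /andP[/negbTE->].
case: z2 => [|b z2] in ev' em *.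
  by exists [:: a], t, [::]; rewrite eu.
rewrite /=; case: eqP => [eb|_]; last by exists [:: a], t, (b :: z2); rewrite eu.
exists [::], (rcons t b), z2; split=> //; last by rewrite cat_rcons.
by rewrite word_inv_rcons eb letterVK eu.
Qed.

Lemma flenV g : flen g^-1 = flen g.
Proof. by rewrite /flen fg_wordV size_word_inv. Qed.

Lemma flenM g h : flen (g * h) <= flen g + flen h.
Proof.
rewrite /flen fg_wordM.
have [z1 [t [z2 [-> -> ->]]]] := word_mul_cancel (fg_word h) (fg_wordP g).
by rewrite !size_cat; lia.
Qed.

Lemma flenM_ge g h : flen h - flen g <= flen (g * h).
Proof. by rewrite leq_subLR -{1}(mulKg g h) -(flenV g) flenM. Qed.

Lemma flenMr_ge g h : flen g - flen h <= flen (g * h).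
Proof. by rewrite leq_subLR -{1}(mulgK h g) -(flenV h) addnC flenM. Qed.

Lemma flen1 : flen 1 = 0. Proof. by []. Qed.

Lemma flen_eq0 g : (flen g == 0) = (g == 1).
Proof.
rewrite /flen; apply/nilP/eqP => [h|->//].
by rewrite -(ev_fg_word g) h ev_nil.
Qed.

Lemma flen_ev w : flen (ev w) <= size w.
Proof.
elim: w => [|a w IHw]; first by rewrite ev_nil.
rewrite ev_cons (leq_trans (flenM _ _)) //=.
by rewrite /flen fg_word_ev // add1n ltnS.
Qed.

(** The block cancelled by [g] lies inside [u]. The second equation keeps track of
    the vertex at which the unaltered part [v] is read. *)
Lemma word_mul_prefix g u v : reduced (u ++ v) -> flen g <= size u ->
  exists q, fg_word (g * ev (u ++ v)) = q ++ v /\ ev q = g * ev u.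
Proof.
move=> r gu; have gr := fg_wordP g.
have [z1 [t [z2 [eg et em]]]] := word_mul_cancel (u ++ v) gr.
have tu : size t <= size u.
  by apply: leq_trans gu; rewrite /flen eg size_cat size_word_inv leq_addl.
have eu : u = t ++ drop (size t) u.
  rewrite -[LHS](cat_take_drop (size t)); congr (_ ++ _).
  have := congr1 (take (size t)) et.
  by rewrite take_cat take_size_cat //; case: ltngtP tu => // -> _;
    rewrite subnn take0 cats0 take_size.
exists (z1 ++ drop (size t) u); rewrite fg_wordM fg_word_ev // em.
split.
  rewrite -catA; congr (_ ++ _); have := congr1 (drop (size t)) et.
  rewrite drop_cat drop_size_cat //; case: ltngtP tu => // e _ <-.
  by rewrite e subnn drop0 drop_size.
rewrite -{1}(ev_fg_word g) eg {2}eu !ev_cat ev_word_inv.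
by rewrite -!mulgA mulKg.
Qed.

(** The axis of a conjugate: the word [m] is read again in the conjugate, from
    the vertex [g * ev u]. *)
Lemma word_conj_middle g u m v : reduced (u ++ m ++ v) ->
    flen g <= size u -> flen g <= size v ->
  exists q s, fg_word (g * ev (u ++ m ++ v) * g^-1) = q ++ m ++ s /\
    ev q = g * ev u.
Proof.
move=> r gu gv; have [q [e1 e2]] := word_mul_prefix r gu.
have rq : reduced (q ++ m ++ v) by rewrite -e1 fg_wordP.
have r' : reduced (word_inv v ++ word_inv (q ++ m)).
  by rewrite -word_inv_cat; apply: reduced_inv; rewrite -?catA.
have gv' : flen g <= size (word_inv v) by rewrite size_word_inv.
have [s [e3 _]] := word_mul_prefix r' gv'.
exists q, (word_inv s); split=> //.
have -> : g * ev (u ++ m ++ v) * g^-1 =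
    (g * ev (word_inv v ++ word_inv (q ++ m)))^-1.
  rewrite -word_inv_cat ev_word_inv -catA -e1 ev_fg_word.
  by rewrite invgM invgK.
by rewrite fg_wordV e3 word_inv_cat word_invK catA.
Qed.

End FreeWords.

(** * Half-trees of the Cayley tree and turns of a word *)

Section HalfTrees.
Variable k : nat.
Implicit Types (a b c : letter k) (u v w x y z : seq (letter k)).
Implicit Types g h : free_group k.
Local Open Scope group_scope.

(** The half-tree of the Cayley tree which lies beyond the edge from [1] to [a].
    Its translate by [v] is the set of all [g] with [starts a (v^-1 * g)]. *)
Definition starts a g := ohead (fg_word g) == Some a.

Lemma startsP a g : reflect (exists w, fg_word g = a :: w) (starts a g).
Proof.
rewrite /starts; case: (fg_word g) => [|b w] /=.
  by apply: (iffP eqP) => // -[].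
by apply: (iffP eqP) => [[->]|[w' [->]]] //; exists w.
Qed.

Lemma starts_ev a w : reduced (a :: w) -> starts a (ev (a :: w)).
Proof. by move=> r; rewrite /starts fg_word_ev. Qed.

Lemma starts_inj a b g : starts a g -> starts b g -> a = b.
Proof. by rewrite /starts => /eqP-> /eqP[]. Qed.

Lemma starts1 a : starts a 1 = false. Proof. by []. Qed.

Lemma starts_ex g : g != 1 -> exists a, starts a g.
Proof.
rewrite -flen_eq0 /flen /starts; case: (fg_word g) => // a w _.
by exists a; rewrite /= eqxx.
Qed.

(** An edge bounds two half-trees: this is how complements are handled, as
    half-trees again. *)
Lemma starts_compl a g :
  starts (letterV a) ((ev [:: a])^-1 * g) = ~~ starts a g.
Proof.
rewrite -ev_letterV /starts fg_wordM fg_word_ev //=.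
have := fg_wordP g; case: (fg_word g) => [|b w] rg /=; first by rewrite eqxx.
rewrite letterVK; case: (altP (b =P a)) => [eb|nb] /=.
  rewrite eb eqxx in rg *; case: w rg => //= c w.
  by rewrite /reduced /= => /andP[/negbTE nc _]; apply/eqP => -[] /eqP;
    rewrite nc.
rewrite eqxx; apply/esym; apply/eqP => -[] /eqP.
by rewrite (negbTE nb).
Qed.

Lemma starts_mulr a g h : flen h < flen g -> starts a (g * h) = starts a g.
Proof.
rewrite /flen /starts fg_wordM.
have [z1 [t [z2 [-> -> ->]]]] := word_mul_cancel (fg_word h) (fg_wordP g).
case: z1 => //=; rewrite !size_cat size_word_inv.
by rewrite ltnNge leq_addr.
Qed.

(** A path with label [w] makes the turn [(a, b)] at a vertex if it arrives there
    from the direction [a] and leaves in the direction [b]; the letter which it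
    reads on arrival is then the inverse of [a]. *)
Fixpoint turns a b w : nat :=
  if w is x :: w' then
    ((x == letterV a) && (ohead w' == Some b)) + turns a b w'
  else 0.

Definition turn2 a b w := turns a b w + turns b a w.

(** For each occurrence of the turn, translate the segment from [1] to [g] so
    that this occurrence takes place at the vertex [1]: by reducedness, the ends
    of the translate lie in the half-trees [a] and [b]. *)
Lemma turns_translates a b g : exists gs : seq (free_group k),
  [/\ uniq gs, size gs = turns a b (fg_word g) &
    {in gs, forall h, starts a h /\ starts b (h * g)}].
Proof.
suff H u2 u1 : reduced (u1 ++ u2) -> exists gs : seq (free_group k),
    [/\ uniq gs, size gs = turns a b u2 &
    {in gs, forall h, [/\ starts a h, starts b (h * ev (u1 ++ u2)) &
      size u1 < flen h]}].
  have [gs [ugs sgs hgs]] := H (fg_word g) [::] (fg_wordP g).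
  exists gs; split=> // h /hgs[]; rewrite cat0s ev_fg_word.
  by move=> ? ?.
elim: u2 u1 => [|x u2 IHu] u1 r; first by exists [::].
have r' : reduced (rcons u1 x ++ u2) by rewrite cat_rcons.
have [gs [ugs sgs hgs]] := IHu _ r'.
have hgs' : {in gs, forall h, [/\ starts a h,
    starts b (h * ev (u1 ++ x :: u2)) & size u1 < flen h]}.
  move=> h /hgs[s1 s2 s3]; split=> //; first by rewrite -cat_rcons.
  by move: s3; rewrite size_rcons => /ltnW.
rewrite [turns _ _ _]/=; case: andP => [[/eqP ex hu2]|_]; last first.
  by exists gs; rewrite add0n.
have [ru1 ru2] := reduced_cat r'.
pose h0 := ev (word_inv (rcons u1 x)).
have fh0 : flen h0 = (size u1).+1.
  by rewrite /h0 /flen fg_word_ev ?reduced_inv // size_word_inv size_rcons.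
exists (h0 :: gs); split.
- rewrite /= ugs andbT; apply/negP => /hgs[_ _].
  by rewrite fh0 size_rcons ltnn.
- by rewrite /= sgs add1n.
- move=> h; rewrite inE => /predU1P[->|/hgs' //]; split; last by rewrite fh0.
    rewrite /starts fg_word_ev ?reduced_inv // word_inv_rcons ex letterVK.
    by rewrite /= eqxx.
  rewrite /h0 ev_word_inv -cat_rcons ev_cat mulKg /starts fg_word_ev //.
Qed.

End HalfTrees.

(** * Cuts of the Cayley tree *)

Lemma fin_uniform_bound (T : finType) (P : T -> nat -> Prop) :
  (forall x, exists M, forall m, M <= m -> P x m) ->
  exists M, forall x m, M <= m -> P x m.
Proof.
move=> /fin_all_exists[f Hf]; exists (\max_x f x) => x m le_m.
by apply: Hf; apply: leq_trans le_m; apply: leq_bigmax.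
Qed.

Lemma uniq_flatten (I T : eqType) (F : I -> seq T) (s : seq I) :
    uniq s -> (forall i, uniq (F i)) ->
    (forall i j x, x \in F i -> x \in F j -> i = j) ->
  uniq (flatten [seq F i | i <- s]).
Proof.
move=> us uF dF; elim: s us => //= i s IHs /andP[is_ us].
rewrite cat_uniq uF IHs // andbT /=; apply/hasP => -[x].
move=> /flatten_mapP[j js xj] xi.
by rewrite (dF i j x xi xj) js in is_.
Qed.

Section Cuts.
Variable k : nat.
Implicit Types (a b d : letter k) (u v w x y z : seq (letter k)) (c : bool).
Implicit Types (g h t : free_group k) (B : free_group k -> bool).
Local Open Scope group_scope.

Lemma card_letter : #|letter k| = (2 * k)%N.
Proof. by rewrite card_prod card_ord card_bool mulnC. Qed.

Lemma ball_finite M : exists s : seq (free_group k),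
  forall g, flen g < M -> g \in s.
Proof.
elim: M => [|M [s hs]]; first by exists [::].
exists (1 :: [seq ev [:: a] * g | a <- enum (letter k), g <- s]) => g.
rewrite inE -[g](ev_fg_word); rewrite /flen fg_word_ev ?fg_wordP //.
have := fg_wordP g; case: (fg_word g) => [|a w] r hM; first by rewrite ev_nil.
apply/orP; right; apply/allpairsP; exists (a, ev w); split=> /=.
- by rewrite mem_enum.
- by apply: hs; rewrite /flen fg_word_ev //; apply: reduced_cons r.
- by rewrite -ev_cons.
Qed.

(** Finitely many edges, since balls are finite. *)
Definition finite_coboundary B :=
  exists M, forall g a, M <= flen g -> B (g * ev [:: a]) = B g.

Definition shift B t g := B (t * g).

Definition mono B a (c : bool) :=
  exists M, forall g, starts a g -> M <= flen g -> B g = c.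

Definition nontrivial_cut B :=
  forall (c : bool) M, exists2 g, M <= flen g & B g = c.

Definition half_tree_like B := exists t b M,
  forall g, M <= flen g -> B g = starts b (t^-1 * g).

(** The number of translates of the segment from [1] to [g] cut by [B], compared
    with a lower bound [m] for the number of occurrences of each turn in [g]. The
    constant [C] absorbs the translates with an end near the coboundary of [B]. *)
Definition cuts_often B N := exists C, forall g m,
    (forall a b, a != b -> m <= turn2 a b (fg_word g)) ->
  exists hs : seq (free_group k),
    [/\ uniq hs, {in hs, forall h, B h != B (h * g)} &
        (N * m <= size hs + C)%N].

Lemma finite_coboundary_shift B t :
  finite_coboundary B -> finite_coboundary (shift B t).
Proof.
move=> [M hM]; exists (M + flen t) => g a le_g; rewrite /shift mulgA hM //.
by apply: leq_trans (flenM_ge _ _); lia.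
Qed.

Lemma nontrivial_shift B t : nontrivial_cut B -> nontrivial_cut (shift B t).
Proof.
move=> nB c M; have [g le_g Bg] := nB c (M + flen t).
exists (t^-1 * g); last by rewrite /shift mulVKg.
by apply: leq_trans (flenM_ge _ _); rewrite flenV; lia.
Qed.

Lemma cuts_often_shift B t N : cuts_often (shift B t) N -> cuts_often B N.
Proof.
move=> [C hC]; exists C => g m /hC[hs [uhs hhs le_hs]].
exists [seq t * h | h <- hs]; split; last by rewrite size_map.
  by rewrite map_inj_uniq //; apply: mulgI.
by move=> _ /mapP[h /hhs hh ->]; rewrite -mulgA.
Qed.

Lemma half_tree_like_shift B t :
  half_tree_like (shift B t) -> half_tree_like B.
Proof.
move=> [s [b [M hM]]]; exists (t * s), b, (M + flen t) => g le_g.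
rewrite invgM -mulgA -hM /shift ?mulVKg //.
by apply: leq_trans (flenM_ge _ _); rewrite flenV; lia.
Qed.

Definition cone_mono B y (c : bool) := exists M, forall z,
  reduced (y ++ z) -> M <= size z -> B (ev (y ++ z)) = c.

Lemma cone_mono_far B : finite_coboundary B -> exists M, forall y,
  M <= size y -> exists c : bool, cone_mono B y c.
Proof.
move=> [M hM]; exists M => y le_y; exists (B (ev y)), 0 => z r _.
elim/last_ind: z r => [|z a IHz]; first by rewrite cats0.
rewrite -rcons_cat => r; rewrite ev_rcons hM.
  by apply: IHz; move: r; rewrite -cats1 => /reduced_cat[].
move: r; rewrite -cats1 => /reduced_cat[r _].
by rewrite /flen fg_word_ev // size_cat; lia.
Qed.

Lemma cone_mono_shift B y d b (c : bool) : b != letterV d -> reduced (rcons y d) ->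
  cone_mono B (rcons (rcons y d) b) c ->
  mono (shift B (ev (rcons y d))) b c.
Proof.
move=> bd ry [M hM]; exists M.+1 => g /startsP[w eg].
rewrite /flen eg /= ltnS => le_w; rewrite /shift.
rewrite -(ev_fg_word g) eg -ev_cat -cat_rcons hM // cat_rcons.
by rewrite reduced_cat_cons // -eg fg_wordP.
Qed.

(** If [B] is not eventually constant on a half-tree, a vertex of this
    half-tree as far as possible with the same defect has all its outer
    directions monochromatic, and both colours occur among them. *)
Lemma deepest_branching B a :
    finite_coboundary B -> ~ (exists c : bool, mono B a c) -> exists y d,
  [/\ reduced (rcons y d), starts a (ev (rcons y d)),
      forall b, b != letterV d ->
        exists c : bool, mono (shift B (ev (rcons y d))) b c &
      forall c : bool, exists2 b, b != letterV d &
        mono (shift B (ev (rcons y d))) b c].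
Proof.
move=> fB na; have [M hM] := cone_mono_far fB.
have na' : ~ exists c : bool, cone_mono B [:: a] c.
  case=> c [N hN]; apply: na; exists c, N.+1 => g /startsP[w eg].
  rewrite /flen eg /= ltnS => le_w.
  have r : reduced (a :: w) by rewrite -eg fg_wordP.
  by rewrite -(ev_fg_word g) eg -cat1s hN.
have [y [d [ry sy ny cy]]] : exists y d, [/\ reduced (rcons y d),
    starts a (ev (rcons y d)), ~ (exists c : bool, cone_mono B (rcons y d) c) &
    forall b, b != letterV d ->
      exists c : bool, cone_mono B (rcons (rcons y d) b) c].
  suff H n y d : M <= size y + n -> reduced (rcons y d) ->
      starts a (ev (rcons y d)) -> ~ (exists c : bool, cone_mono B (rcons y d) c) ->
    exists y d, [/\ reduced (rcons y d),
      starts a (ev (rcons y d)), ~ (exists c : bool, cone_mono B (rcons y d) c) &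
      forall b, b != letterV d ->
        exists c : bool, cone_mono B (rcons (rcons y d) b) c].
    by apply: (H M [::] a) => //; rewrite ?leq_addl // starts_ev.
  elim: n y d => [|n IHn] y d le_M ry sy ny.
    by case: ny; apply: hM; rewrite size_rcons; lia.
  have [|nb] := pselect (forall b, b != letterV d ->
      exists c : bool, cone_mono B (rcons (rcons y d) b) c).
    by move=> h; exists y, d.
  have /existsNP[b /not_implyP[bd nb']] := nb.
  apply: (IHn (rcons y d) b) => //; first by rewrite size_rcons; lia.
    exact: reduced_rcons.
  move/startsP: sy => [w]; rewrite fg_word_ev // => ew.
  rewrite ew rcons_cons starts_ev // -rcons_cons -ew.
  exact: reduced_rcons.
exists y, d; split=> //.
  move=> b bd; have [c hc] := cy b bd; exists c.
  exact: cone_mono_shift.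
move=> c; apply: contrapT => nc; apply: ny; exists (~~ c).
have H b : exists N, forall n, N <= n -> b != letterV d -> forall z,
    reduced (rcons (rcons y d) b ++ z) -> n <= size z ->
    B (ev (rcons (rcons y d) b ++ z)) = ~~ c.
  have [ebd|bd] := eqVneq b (letterV d).
    by exists 0 => n _ /eqP.
  have [c' hc'] := cy b bd; have [ec|nec] := eqVneq c' c.
    case: nc; exists b => //; rewrite -ec.
    exact: cone_mono_shift.
  have [N hN] := hc'; exists N => n le_n _ z rz le_z.
  rewrite hN ?(leq_trans le_n) //.
  by case: (c) (c') nec => -[].
have [N hN] := fin_uniform_bound H; exists N.+1 => -[|b z] //= r.
rewrite ltnS => le_z; rewrite -cat_rcons in r *; apply: (hN b N) => //.
by have [/reduced_rcons2] := reduced_cat r.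
Qed.

(** If the directions [S] at the vertex [1] are coloured by [B], each turn with
    ends of distinct colours yields translates cut by [B], and distinct turns
    yield distinct translates because the half-trees are disjoint. *)
Lemma star_translates B (S : {set letter k}) (col : letter k -> bool) M :
    (forall a g, a \in S -> starts a g -> M <= flen g -> B g = col a) ->
  exists C, forall g m,
    (forall a b, a != b -> m <= turn2 a b (fg_word g)) ->
  exists hs : seq (free_group k),
    [/\ uniq hs,
        {in hs, forall h, B h != B (h * g) /\ exists2 a, a \in S & starts a h} &
        (#|[set a in S | col a]| * #|[set a in S | ~~ col a]| * m
           <= size hs + C)%N].
Proof.
move=> hcol; have [ball hball] := ball_finite M.
exists (size ball + size ball)%N => g m hm.
have [gs hgs] : exists gs : letter k -> letter k -> seq (free_group k),
    forall a b, [/\ uniq (gs a b), size (gs a b) = turns a b (fg_word g) &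
      {in gs a b, forall h, starts a h /\ starts b (h * g)}].
  have [f hf] := choice (fun p : letter k * letter k =>
    turns_translates p.1 p.2 g).
  by exists (fun a b => f (a, b)) => a b; apply: hf (a, b).
set S1 := [set a in S | col a]; set S0 := [set a in S | ~~ col a].
pose ps := [seq (a, b) | a <- enum S1, b <- enum S0].
have ups : uniq ps.
  by apply: allpairs_uniq => [||[? ?] [? ?] _ _ [-> ->]] //; apply: enum_uniq.
have hps p : p \in ps -> [/\ p.1 \in S, col p.1, p.2 \in S & ~~ col p.2].
  case/allpairsP=> -[a b] [/=]; rewrite !mem_enum !inE.
  by move=> /andP[? ?] /andP[? ?] ->.
pose l1 := flatten [seq gs p.1 p.2 | p <- ps].
pose l2 := flatten [seq gs p.2 p.1 | p <- ps].
have inj a b a' b' h : h \in gs a b -> h \in gs a' b' -> a = a' /\ b = b'.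
  have [_ _ H] := hgs a b; have [_ _ H'] := hgs a' b'.
  move=> /H[s1 s2] /H'[s1' s2'].
  by split; [apply: starts_inj s1 s1' | apply: starts_inj s2 s2'].
have u1 : uniq l1.
  apply: uniq_flatten => // -[a b]; first by case: (hgs a b).
  by move=> [a' b'] h h1 h2; case: (inj _ _ _ _ _ h1 h2) => /= -> ->.
have u2 : uniq l2.
  apply: uniq_flatten => // -[a b]; first by case: (hgs b a).
  by move=> [a' b'] h h1 h2; case: (inj _ _ _ _ _ h1 h2) => /= -> ->.
have m1 h : h \in l1 -> exists a b,
    [/\ starts a h, starts b (h * g), a \in S, b \in S & col a && ~~ col b].
  move=> /flatten_mapP[[a b] /hps[/= ? ca ? cb]].
  have [_ _ H] := hgs a b; move=> /H[? ?]; exists a, b.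
  by rewrite ca cb.
have m2 h : h \in l2 -> exists a b,
    [/\ starts a h, starts b (h * g), a \in S, b \in S & ~~ col a && col b].
  move=> /flatten_mapP[[a b] /hps[/= ? ca ? cb]].
  have [_ _ H] := hgs b a; move=> /H[? ?]; exists b, a.
  by rewrite ca cb.
have u12 : uniq (l1 ++ l2).
  rewrite cat_uniq u1 u2 andbT; apply/hasP => -[h /m2[a [b [sa _ _ _ /andP[ca _]]]]].
  move=> /m1[a' [b' [sa' _ _ _ /andP[ca' _]]]].
  by rewrite (starts_inj sa sa') ca' in ca.
(* The colours are only known outside a ball: discard the few translates having
   an end in it. *)
pose far h := (M <= flen h) && (M <= flen (h * g)).
have m12 h : h \in l1 ++ l2 -> far h ->
    B h != B (h * g) /\ exists2 a, a \in S & starts a h.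
  rewrite mem_cat => /orP[/m1|/m2] [a [b [sa sb aS bS /andP[ca cb]]]] /andP[f1 f2].
    rewrite (hcol a) // (hcol b) // ca (negbTE cb); split=> //.
    by exists a.
  rewrite (hcol a) // (hcol b) // cb (negbTE ca); split=> //.
  by exists a.
exists (seq.filter far (l1 ++ l2)); split.
- exact: filter_uniq.
- by move=> h; rewrite mem_filter => /andP[fh hh]; apply: m12.
have le_ball (s : seq (free_group k)) (f : free_group k -> free_group k) :
    injective f -> uniq s -> {in s, forall h, flen (f h) < M} ->
  size s <= size ball.
  move=> injf us hs; rewrite -(size_map f); apply: uniq_leq_size.
    by rewrite map_inj_uniq.
  by move=> _ /mapP[h /hs hh ->]; apply: hball.
have size12 : size (l1 ++ l2) <=
    (size (seq.filter far (l1 ++ l2)) + (size ball + size ball))%N.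
  rewrite -(count_predC far) size_filter leq_add2l.
  apply: (@leq_trans (addn (count (fun h => flen h < M) (l1 ++ l2))
                           (count (fun h => flen (h * g) < M) (l1 ++ l2)))).
    rewrite -count_predUI; apply: leq_trans (leq_addr _ _).
    by apply: sub_count => h; rewrite /= /far negb_and -!ltnNge.
  apply: leq_add; rewrite -size_filter.
    apply: (le_ball _ id) => //; first exact: filter_uniq.
    by move=> h; rewrite mem_filter => /andP[].
  apply: (le_ball _ (fun h => h * g)); first exact: mulIg.
    exact: filter_uniq.
  by move=> h; rewrite mem_filter => /andP[].
apply: leq_trans size12.
rewrite size_cat !size_flatten /shape -!map_comp !sumnE !big_map -big_split /=.
have -> : (#|S1| * #|S0| * m = \sum_(p <- ps) m)%N.
  by rewrite big_const_seq count_predT iter_addn_0 mulnC size_allpairs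
    -!cardE.
rewrite big_seq [leqRHS]big_seq; apply: leq_sum => -[a b] /hps[/= _ ca _ cb].
have [_ -> _] := hgs a b; have [_ -> _] := hgs b a; apply: hm.
by apply: contraNneq cb => <-.
Qed.

Lemma star_mono B (S : {set letter k}) :
    (forall a, a \in S -> exists c : bool, mono B a c) ->
  exists col M, forall a g, a \in S -> starts a g -> M <= flen g -> B g = col a.
Proof.
move=> H; have [col hcol] : exists col : letter k -> bool,
    forall a, a \in S -> mono B a (col a).
  apply: (fin_all_exists (P := fun a (c : bool) => a \in S -> mono B a c)) => a.
  have [/H[c hc]|_] := boolP (a \in S); first by exists c.
  by exists true.
have [M hM] : exists M, forall a n, M <= n -> a \in S ->
    forall g, starts a g -> n <= flen g -> B g = col a.
  apply: fin_uniform_bound => a.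
  have [/hcol[M hM]|_] := boolP (a \in S); last by exists 0.
  by exists M => m le_m _ g sg le_g; apply: hM => //; apply: leq_trans le_g.
by exists col, M => a g aS sg le_g; apply: (hM a M).
Qed.

Lemma card_split (S : {set letter k}) (col : letter k -> bool) :
  (#|[set a in S | col a]| + #|[set a in S | ~~ col a]| = #|S|)%N.
Proof.
rewrite -(cardsID [set a | col a] S); congr (_ + _)%N; apply: eq_card => a.
  by rewrite !inE.
by rewrite !inE andbC.
Qed.

Definition cut_dichotomy B :=
  cuts_often B (2 * (2 * k - 2)) \/
  half_tree_like B /\ cuts_often B (2 * k - 1).

Lemma cut_dichotomy_shift B t : cut_dichotomy (shift B t) -> cut_dichotomy B.
Proof.
case=> [/cuts_often_shift|[/half_tree_like_shift ? /cuts_often_shift ?]].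
  by left.
by right.
Qed.

Hypothesis hk : 2 <= k.

Lemma letter_avoid2 a b : exists d, d != a /\ d != b.
Proof.
have : ~~ ([set: letter k] \subset [set a; b]).
  apply/negP => /subset_leq_card; rewrite cardsT card_letter cards2.
  by case: eqP => _ /=; lia.
by case/subsetPn=> c _; rewrite !inE negb_or => /andP[]; exists c.
Qed.

(** A vertex all of whose directions are monochromatic, [j] of them of one
    colour: at least [j * (2 * k - j)] turns at this vertex are cut. *)
Lemma cut_dichotomy_star B : nontrivial_cut B ->
  (forall a, exists c : bool, mono B a c) -> cut_dichotomy B.
Proof.
move=> nB H; have [a _|col [M hM]] := @star_mono B [set: letter k].
  exact: H.
have [C hC] := star_translates hM.
pose s c := [set a in [set: letter k] | col a == c].
have s1 : [set a in [set: letter k] | col a] = s true.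
  by apply/setP => a; rewrite !inE eqb_id.
have s0 : [set a in [set: letter k] | ~~ col a] = s false.
  by apply/setP => a; rewrite !inE eqbF_neg.
have sgt0 c : 0 < #|s c|.
  have [g le_g Bg] := nB c (maxn M 1).
  have [|a sa] := @starts_ex _ g.
    by rewrite -flen_eq0 -lt0n; apply: leq_trans le_g; rewrite leq_maxr.
  apply/card_gt0P; exists a; rewrite !inE -(hM a g) ?Bg ?eqxx //.
  by apply: leq_trans le_g; rewrite leq_maxl.
have sD : (#|s true| + #|s false| = 2 * k)%N.
  by rewrite -s1 -s0 card_split cardsT card_letter.
have often N : (N <= #|s true| * #|s false|)%N -> cuts_often B N.
  move=> leN; exists C => g m /hC[hs [uhs hhs le_hs]].
  exists hs; split=> //; first by move=> h /hhs[].
  by apply: leq_trans le_hs; rewrite s1 s0 leq_mul2r leN orbT.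
have col_s a c : col a = c -> a \in s c by move=> <-; rewrite !inE eqxx.
have large g : maxn M 1 <= flen g -> M <= flen g /\ exists a, starts a g.
  rewrite geq_max => /andP[-> g1]; split=> //; apply: starts_ex.
  by rewrite -flen_eq0 -lt0n.
have [[c /eqP/cards1P[b sb]]|no1] := pselect (exists c, #|s c| = 1%N); last first.
  left; apply: often; have p1 := sgt0 true; have p0 := sgt0 false.
  have n1 : #|s true| <> 1%N by move=> e; apply: no1; exists true.
  have n0 : #|s false| <> 1%N by move=> e; apply: no1; exists false.
  by nia.
right; split; last first.
  apply: often; have p1 := sgt0 true; have p0 := sgt0 false.
  by nia.
have colb a : (col a == c) = (a == b).
  by have : (a \in s c) = (a == b) by [rewrite sb inE]; rewrite !inE.
case: c => [] in sb colb *.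
  exists 1, b, (maxn M 1) => g /large[le_g [a sa]]; rewrite invg1 mul1g.
  rewrite (hM a) ?inE // -[col a]eqb_id colb.
  apply/eqP/idP => [<- //|sb']; exact: starts_inj sa sb'.
exists (ev [:: b]), (letterV b), (maxn M 1) => g /large[le_g [a sa]].
rewrite starts_compl (hM a) ?inE //; apply: negb_inj.
rewrite negbK -eqbF_neg colb; apply/eqP/idP => [<- //|sb']; exact: starts_inj sa sb'.
Qed.

(** Main estimate on cuts. Either some vertex has all its directions
    monochromatic, or there are two branching vertices, each seeing both colours
    among its directions away from the other: the turns that they cut are then
    distinct. *)
Lemma cut_dichotomyP B : finite_coboundary B -> nontrivial_cut B ->
  cut_dichotomy B.
Proof.
move=> fB nB.
have [|/existsNP[a na]] := pselect (forall a, exists c : bool, mono B a c).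
  exact: cut_dichotomy_star.
have [y [d [ry _ monoy coly]]] := deepest_branching fB na.
apply: (@cut_dichotomy_shift _ (ev (rcons y d))).
set B1 := shift B _ in monoy coly *.
have fB1 : finite_coboundary B1 by apply: finite_coboundary_shift.
have nB1 : nontrivial_cut B1 by apply: nontrivial_shift.
have [hd|nd] := pselect (exists c : bool, mono B1 (letterV d) c).
  apply: cut_dichotomy_star => // b.
  by have [->//|/monoy] := eqVneq b (letterV d).
have [y2 [d2 [ry2 sy2 monoy2 coly2]]] := deepest_branching fB1 nd.
left; set e := letterV d in monoy coly nd sy2 *.
have often (B' : free_group k -> bool) f :
    (forall b, b != f -> exists c : bool, mono B' b c) ->
    (forall c : bool, exists2 b, b != f & mono B' b c) ->
  exists C, forall g m, (forall a b, a != b -> m <= turn2 a b (fg_word g)) ->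
  exists hs : seq (free_group k), [/\ uniq hs,
    {in hs, forall h, B' h != B' (h * g) /\ exists2 a, a != f & starts a h} &
    ((2 * k - 2) * m <= size hs + C)%N].
  move=> monoB colB; have [b|col [M hM]] := @star_mono B' [set~ f].
    by rewrite !inE => /monoB.
  have [C hC] := star_translates hM; exists C => g m /hC[hs [uhs hhs le_hs]].
  exists hs; split=> //.
    by move=> h /hhs[? [b]]; rewrite !inE => bf sb; split=> //; exists b.
  apply: leq_trans le_hs; rewrite leq_mul2r; apply/orP; right.
  have cardS : #|[set~ f]| = (2 * k - 1)%N by rewrite cardsC1 card_letter subn1.
  have := card_split [set~ f] col; rewrite cardS.
  have gt0 c : exists2 b, b != f & col b = c.
    have [b bf [N hN]] := colB c; exists b => //.
    pose g0 := ev (nseq (maxn N M).+1 b).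
    have lg0 : flen g0 = (maxn N M).+1.
      by rewrite /flen fg_word_ev ?size_nseq //; apply: reduced_nseq.
    have sg0 : starts b g0 by rewrite starts_ev //; apply: (reduced_nseq b _.+1).
    rewrite -(hM b g0) ?hN ?lg0 ?inE //.
      by rewrite ltnW // ltnS leq_maxl.
    by rewrite ltnW // ltnS leq_maxr.
  have p1 : 0 < #|[set b in [set~ f] | col b]|.
    have [b bf cb] := gt0 true; apply/card_gt0P; exists b.
    by rewrite !inE bf cb.
  have p0 : 0 < #|[set b in [set~ f] | ~~ col b]|.
    have [b bf cb] := gt0 false; apply/card_gt0P; exists b.
    by rewrite !inE bf cb.
  by nia.
have [C1 hC1] := often B1 e monoy coly.
have [C2 hC2] := often _ (letterV d2) monoy2 coly2.
exists (C1 + C2)%N => g m hm.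
have [hs1 [u1 m1 le1]] := hC1 g m hm; have [hs2 [u2 m2 le2]] := hC2 g m hm.
exists (hs1 ++ [seq ev (rcons y2 d2) * h | h <- hs2]); split.
- rewrite cat_uniq u1 map_inj_uniq ?u2 ?andbT //; last exact: mulgI.
  apply/hasP => -[_ /mapP[h /m2[_ [b bd sb]] ->] /m1[_ [b' be sb']]].
  move: be; rewrite (@starts_inj _ b' e (ev (rcons y2 d2) * h)) ?eqxx //.
  move/startsP: sb => [w ew]; move/startsP: sy2 => [w'].
  rewrite fg_word_ev // => ew'.
  have r : reduced (rcons y2 d2 ++ b :: w).
    by rewrite reduced_cat_cons // -ew fg_wordP.
  rewrite -(ev_fg_word h) ew -ev_cat ew' /= starts_ev //.
  by move: r; rewrite ew'.
- move=> h; rewrite mem_cat => /orP[/m1[]//|/mapP[h' /m2[+ _] ->]].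
  by rewrite /shift mulgA.
- by rewrite size_cat size_map -mulnA mul2n -addnn; lia.
Qed.

End Cuts.

(** * Length of the image of a word under an automorphism *)

Section GroupMorphisms.
Variables (G H : groupType) (f : G -> H).
Hypothesis fM : {morph f : x y / (x * y)%g}.
Local Open Scope group_scope.

Lemma gmorph1 : f 1 = 1.
Proof. by apply: (mulgI (f 1)); rewrite -fM !mulg1. Qed.

Lemma gmorphV x : f x^-1 = (f x)^-1.
Proof. by apply: (mulgI (f x)); rewrite -fM !mulgV gmorph1. Qed.

Lemma gmorphX x n : f (x ^+ n) = f x ^+ n.
Proof. by elim: n => [|n IHn]; rewrite ?gmorph1 // !expgS fM IHn. Qed.

End GroupMorphisms.

Section Length.
Variable k : nat.
Implicit Types (a b d : letter k) (u v w x y z : seq (letter k)) (c : bool).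
Implicit Types (g h t : free_group k).
Local Open Scope group_scope.

Lemma starts_mul_letter (i : 'I_k) a h :
    starts (i, true) h != starts (i, true) (h * ev [:: a]) ->
  a.1 = i /\ h = if a.2 then 1 else ev [:: letterV a].
Proof.
have fa : flen (ev [:: a]) = 1%N by rewrite /flen fg_word_ev.
have [lt1|] := ltnP 1 (flen h); first by rewrite starts_mulr ?fa // eqxx.
rewrite -{2 3 4}(ev_fg_word h) /flen {1}/starts.
case: (fg_word h) => [|b [|//]] _.
  rewrite ev_nil mul1g /starts fg_word_ev //= -[None == _]/false.
  by case: a {fa} => j c /=; case: (Some (j, c) =P _) => // -[-> ->].
rewrite /starts fg_wordM !fg_word_ev //=.
case: (altP (a =P letterV b)) => [->|_] /=; last by rewrite eqxx.
rewrite letterVK -[None == _]/false.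
by case: b => j c /=; case: (Some (j, c) =P _) => // -[-> ->].
Qed.

(** The letters of [g] are the edges crossed by the segment from [1] to [g], and
    a half-tree cuts this segment when its boundary edge is crossed. *)
Lemma size_crossing_translates (i : 'I_k) g (hs : seq (free_group k)) :
    uniq hs ->
    {in hs, forall h, starts (i, true) h != starts (i, true) (h * g)} ->
  size hs <= count (fun a : letter k => a.1 == i) (fg_word g).
Proof.
move=> uhs hhs; have {hhs} : forall h, h \in hs ->
    starts (i, true) h != starts (i, true) (h * ev (fg_word g)).
  by move=> h /hhs; rewrite ev_fg_word.
elim: (fg_word g) hs uhs => [|a w IHw] hs uhs hhs.
  case: hs uhs hhs => // h hs _ /(_ h (mem_head _ _)).
  by rewrite ev_nil mulg1 eqxx.
pose P h := starts (i, true) h != starts (i, true) (h * ev [:: a]).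
rewrite -(count_predC P) /= -!size_filter leq_add //; last first.
  rewrite -(size_map (fun h => h * ev [:: a])) size_filter.
  rewrite -[X in _ <= X]/(count (fun b : letter k => b.1 == i) w).
  apply: IHw; first by rewrite map_inj_uniq ?filter_uniq //; apply: mulIg.
  move=> _ /mapP[h + ->]; rewrite mem_filter => /andP[/= nP /hhs].
  by rewrite ev_cons mulgA; move/negbNE/eqP: nP => ->.
apply: (@leq_trans (size (if a.1 == i then
    [:: if a.2 then 1 else ev [:: letterV a]] else [::]))); last by case: ifP.
apply: uniq_leq_size; first exact: filter_uniq.
move=> h; rewrite mem_filter => /andP[/starts_mul_letter[-> ->] _].
by rewrite eqxx mem_head.
Qed.

Lemma sum_count_letters w :
  \sum_(i < k) count (fun a : letter k => a.1 == i) w = size w.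
Proof.
elim: w => [|a w IHw] /=; first by rewrite big1.
rewrite big_split /= IHw (bigD1 a.1) //= eqxx big1 ?addn0 ?add1n // => i.
by rewrite eq_sym => /negbTE->.
Qed.

Section Automorphism.
Variables f f' : free_group k -> free_group k.
Hypotheses (fM : {morph f : g h / g * h}) (fK : cancel f f').
Hypothesis (fK' : cancel f' f).

Lemma bijection_proper (e e' : free_group k -> free_group k) :
  cancel e e' -> forall N, exists M, forall g, M <= flen g -> N <= flen (e g).
Proof.
move=> eK N; have [s hs] := ball_finite k N.
exists (\max_(h <- s) flen (e' h)).+1 => g le_g; rewrite leqNgt.
apply/negP => /hs gs; move: le_g; rewrite ltnNge; case/negP.
by rewrite -{1}[g]eK; apply: (leq_bigmax_seq (F := fun h => flen (e' h))).
Qed.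

Definition pull_cut a g := starts a (f g).

Lemma pull_cut_finite a : finite_coboundary (pull_cut a).
Proof.
have [M hM] := bijection_proper fK (\max_b flen (f (ev [:: b]))).+1.
exists M => g b /hM le_g; rewrite /pull_cut fM starts_mulr //.
apply: leq_ltn_trans le_g.
by apply: (leq_bigmax (F := fun d => flen (f (ev [:: d])))).
Qed.

Lemma pull_cut_nontrivial a : nontrivial_cut (pull_cut a).
Proof.
move=> c M; have [N hN] := bijection_proper fK' M.
pose b := if c then a else letterV a.
have fl : flen (ev (nseq N.+1 b)) = N.+1.
  by rewrite /flen fg_word_ev ?size_nseq //; apply: reduced_nseq.
exists (f' (ev (nseq N.+1 b))); first by apply: hN; rewrite fl.
rewrite /pull_cut fK' /starts fg_word_ev; last exact: (reduced_nseq b N.+1).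
rewrite /= /b; case: c b fl => _ _; first by rewrite eqxx.
by apply/eqP => -[] /eqP; rewrite (negbTE (letterV_neq a)).
Qed.

Lemma cuts_often_count i N : cuts_often (pull_cut (i, true)) N ->
  exists C, forall g m, (forall a b, a != b -> m <= turn2 a b (fg_word g)) ->
    (N * m <= count (fun a : letter k => a.1 == i) (fg_word (f g)) + C)%N.
Proof.
move=> [C hC]; exists C => g m /hC[hs [uhs hhs le_hs]].
apply: leq_trans le_hs _; rewrite leq_add2r -(size_map f).
apply: size_crossing_translates.
  by rewrite map_inj_uniq //; apply: can_inj fK.
by move=> _ /mapP[h /hhs hh ->]; rewrite -fM.
Qed.

Hypothesis hk : 2 <= k.

(** If the pull-back of some basic half-tree is not a half-tree, then [f]
    lengthens the words in which all turns are almost equally frequent: in such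
    a word of length [n], each of the [k * (2 * k - 1)] turns occurs about
    [n / (k * (2 * k - 1))] times. *)
Lemma length_gain :
    (exists i, ~ half_tree_like (pull_cut (i, true))) ->
  exists C, forall g m, (forall a b, a != b -> m <= turn2 a b (fg_word g)) ->
    ((k * (2 * k - 1) + 1) * m <= flen (f g) + C)%N.
Proof.
move=> [i0 n0].
(* [2 * (2 * k - 2)] is at least [2 * k - 1], and at least [2 * k]: each generator
   contributes [2 * k - 1], and the generator [i0] one more. *)
have [N [hN hN0 hc]] : exists N : 'I_k -> nat,
    [/\ forall i, (2 * k - 1 <= N i)%N, (2 * k <= N i0)%N &
        forall i, cuts_often (pull_cut (i, true)) (N i)].
  exists (fun i => if pselect (half_tree_like (pull_cut (i, true)))
    then (2 * k - 1)%N else (2 * (2 * k - 2))%N); split => [i||i].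
  - by case: pselect => _ /=; lia.
  - by case: pselect => //= _; lia.
  - case: pselect => /= h; have := cut_dichotomyP hk
      (pull_cut_finite (i, true)) (pull_cut_nontrivial (i, true)).
      case=> [[C hC]|[]//]; exists C => g m /hC[hs [uhs hhs le_hs]].
      by exists hs; split=> //; apply: leq_trans le_hs; rewrite leq_mul2r; lia.
    by case=> // -[].
have [C hC] := fin_all_exists (fun i => cuts_often_count (hc i)).
exists (\sum_i C i)%N => g m hm.
rewrite /flen -sum_count_letters -big_split /=.
apply: (@leq_trans (\sum_i N i * m)%N); last first.
  by apply: leq_sum => i _; apply: hC.
rewrite -big_distrl leq_mul2r /=; apply/orP; right.
rewrite (bigD1 i0) //=; apply: (@leq_trans (2 * k +
  \sum_(i < k | i != i0) (2 * k - 1))%N).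
  by rewrite sum_nat_const cardC1 card_ord; nia.
by apply: leq_add => //; apply: leq_sum.
Qed.

End Automorphism.
End Length.

(** * Automorphisms preserving half-trees *)

Section Rigidity.
Variable k : nat.
Implicit Types (a b d : letter k) (u v w x y z : seq (letter k)) (c : bool).
Implicit Types (g h t : free_group k) (B : free_group k -> bool).
Local Open Scope group_scope.

Definition signed_perm (s : {perm letter k}) :=
  forall a, s (letterV a) = letterV (s a).

(** Whitehead's relabelling automorphisms, up to inner ones. *)
Definition simple_aut (f : free_group k -> free_group k) := exists t s,
  signed_perm s /\ forall g, f g = t * ev (map s (fg_word g)) * t^-1.

Lemma starts_extend a g d n : starts a g ->
  d != letterV (last a (behead (fg_word g))) ->
  starts a (g * ev (nseq n d)).
Proof.
move=> /startsP[w ew]; have := fg_wordP g; rewrite ew /= => r hd.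
rewrite -(ev_fg_word g) ew -ev_cat /starts fg_word_ev //.
case: n => [|n]; first by rewrite cats0.
case: (lastP w) r hd => [|w' e] r hd.
  rewrite -[_ ++ _]/(rcons [::] a ++ d :: nseq n d) reduced_cat_cons //.
  exact: (reduced_nseq d n.+1).
rewrite -rcons_cons reduced_cat_cons //; first exact: (reduced_nseq d n.+1).
by move: hd; rewrite last_rcons.
Qed.

(** Right multiplication by a letter does not affect the first letter of a word of
    length at least [2]. *)
Lemma starts_exit b d g : starts b g -> ~~ starts b (g * ev [:: d]) ->
  g = ev [:: b] /\ d = letterV b.
Proof.
have fd : flen (ev [:: d]) = 1%N by rewrite /flen fg_word_ev.
have [lt1|] := ltnP 1 (flen g); first by rewrite starts_mulr ?fd // => ->.
move=> le1 /startsP[w ew]; move: le1; rewrite /flen ew; case: w ew => // ew _.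
have -> : g = ev [:: b] by rewrite -ew ev_fg_word.
rewrite /starts fg_wordM !fg_word_ev //=.
by case: (d =P letterV b) => [->|] //=; rewrite eqxx.
Qed.

Lemma half_tree_like_compl B : half_tree_like B ->
  half_tree_like (fun g => ~~ B g).
Proof.
move=> [t [b [M hM]]]; exists (t * ev [:: b]), (letterV b), M => g le_g.
by rewrite invgM -mulgA starts_compl hM.
Qed.

Hypothesis hk : 2 <= k.

(** A common element can be prolonged arbitrarily without leaving either half-tree:
    it suffices that the first new letter avoids two given ones. *)
Lemma half_trees_disjoint t t' a a' M :
    (forall g, M <= flen g -> ~~ (starts a (t * g) && starts a' (t' * g))) ->
  forall g, ~~ (starts a (t * g) && starts a' (t' * g)).
Proof.
move=> H g; apply/negP => /andP[s1 s2].
have [d [d1 d2]] := letter_avoid2 hk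
  (letterV (last a (behead (fg_word (t * g)))))
  (letterV (last a' (behead (fg_word (t' * g))))).
have le_M : M <= flen (g * ev (nseq (M + flen g) d)).
  apply: leq_trans (flenM_ge _ _).
  rewrite {1}/flen fg_word_ev ?size_nseq; last exact: reduced_nseq.
  by rewrite addnK.
by have := H _ le_M; rewrite !mulgA !starts_extend.
Qed.

Section StandardCuts.
Variables f f' : free_group k -> free_group k.
Hypotheses (fM : {morph f : g h / g * h}) (fK : cancel f f').
Hypothesis (fK' : cancel f' f).
Hypothesis f_half : forall i, half_tree_like (pull_cut f (i, true)).

Lemma half_tree_like_letter a : half_tree_like (pull_cut f a).
Proof.
case: a => i []; first exact: f_half.
have e : pull_cut f (i, false) =
    fun g => ~~ shift (pull_cut f (i, true)) (f' (ev [:: (i, true)])) g.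
  apply/funext => g; rewrite /shift /pull_cut fM fK' -starts_compl.
  by rewrite mulKg.
rewrite e; apply: half_tree_like_compl.
apply: (@half_tree_like_shift _ _ (f' (ev [:: (i, true)]))^-1).
set B := pull_cut f _; rewrite (_ : shift _ _ = B); first exact: f_half.
by apply/funext => g; rewrite /shift mulVKg.
Qed.

(** The half-trees to which the basic ones are pulled back are disjoint and
    cover almost everything; hence they are the basic half-trees issued from one
    vertex [t]. *)
Lemma pulled_half_trees : exists t (s : letter k -> letter k) M,
  injective s /\ forall a g, M <= flen g ->
    starts a (f g) = starts (s a) (t^-1 * g).
Proof.
have [tb htb] : exists tb : letter k -> free_group k * letter k,
    forall a, exists M, forall g, M <= flen g ->
      starts a (f g) = starts (tb a).2 ((tb a).1^-1 * g).
  apply: (fin_all_exists (P := fun a (tb : free_group k * letter k) =>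
    exists M, forall g, M <= flen g ->
      starts a (f g) = starts tb.2 (tb.1^-1 * g))) => a.
  have [t [b [M hM]]] := half_tree_like_letter a.
  by exists (t, b), M.
pose t a := (tb a).1; pose b a := (tb a).2.
have [M hM] : exists M, forall a n, M <= n -> forall g, n <= flen g ->
    starts a (f g) = starts (b a) ((t a)^-1 * g).
  apply: fin_uniform_bound => a; have [N hN] := htb a.
  by exists N => n le_n g le_g; apply: hN; apply: leq_trans le_g.
have {}hM a g : M <= flen g ->
    starts a (f g) = starts (b a) ((t a)^-1 * g) by exact: hM.
pose D a g := starts (b a) ((t a)^-1 * g).
have disj a a' g : D a g -> D a' g -> a = a'.
  move=> h h'; apply/eqP/negPn/negP => ne.
  have /negP[] : ~~ (D a g && D a' g); last by rewrite h h'.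
  apply: (@half_trees_disjoint _ _ _ _ M) => {h h'} g le_g.
  apply/negP; rewrite -!hM // => /andP[h h'].
  by rewrite (starts_inj h h') eqxx in ne.
have [N hN] := bijection_proper fK 1.
have cover g : maxn M N <= flen g -> exists a, D a g.
  rewrite geq_max => /andP[le_M /hN]; rewrite lt0n flen_eq0 => /starts_ex[a].
  by rewrite hM //; exists a.
have Dta a : D a (t a * ev [:: b a]) by rewrite /D mulKg starts_ev.
have [a0 _] : exists a0 : letter k, True.
  by case: (k) hk => // m _; exists (ord0, true).
(* The vertex [g0] lies in none of the half-trees [D a]: otherwise one of them
   would be the complement of [D a0], leaving no room for a third one. *)
pose g0 := t a0.
have nD0 a : ~~ D a g0.
  apply/negP => Da; have ne : a != a0.
    by apply: contraL Da => /eqP->; rewrite /D mulVg starts1.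
  have nDa : ~~ D a (g0 * ev [:: b a0]).
    by apply: contra ne => Da'; rewrite (disj _ _ _ Da' (Dta a0)).
  rewrite /D mulgA in nDa; have [e1 e2] := starts_exit Da nDa.
  have Dc g : D a g = ~~ D a0 g.
    have -> : D a g = starts (b a) (ev [:: b a] * (g0^-1 * g)).
      by rewrite -e1 -mulgA mulVKg.
    by rewrite /D e2 -/g0 -[in RHS](mulKg (ev [:: b a]) (g0^-1 * g))
      starts_compl negbK.
  have [a2 [n1 n2]] := letter_avoid2 hk a a0.
  have notD e : a2 != e -> D e (t a2 * ev [:: b a2]) = false.
    move=> ne2; apply/negP => h; rewrite (disj _ _ _ (Dta a2) h) in ne2.
    by rewrite eqxx in ne2.
  by have := Dc (t a2 * ev [:: b a2]); rewrite !notD.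
(* Seen from [g0], [D a] consists of the words with a given prefix; as every letter
   must be the first letter of one of these prefixes, each is the first letter of
   exactly one, and the prefix has no second letter since [D] covers almost
   everything. *)
pose s a := g0^-1 * t a.
have prefixD a h : D a (g0 * h) ->
    exists w, fg_word h = fg_word (s a) ++ b a :: w.
  have -> : D a (g0 * h) = starts (b a) ((s a)^-1 * h).
    by rewrite /D /s invgM invgK mulgA.
  move=> /startsP[w ew]; exists w.
  have r : reduced (b a :: w) by rewrite -ew fg_wordP.
  have -> : h = ev (fg_word (s a) ++ b a :: w).
    by rewrite ev_cat -ew !ev_fg_word mulVKg.
  rewrite fg_word_ev //; have := nD0 a; rewrite /D.
  have -> : (t a)^-1 * g0 = (s a)^-1 by rewrite invgM invgK.
  rewrite /starts fg_wordV; have := fg_wordP (s a).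
  case/lastP: (fg_word (s a)) => [|u e] ru //.
  rewrite word_inv_rcons /= => ne; apply: reduced_cat_cons => //.
  by apply: contra ne => /eqP->.
pose sg a := head (b a) (fg_word (s a)).
have head_sg a h : D a (g0 * h) -> exists w, fg_word h = sg a :: w.
  move=> /prefixD[w ->]; rewrite /sg; case: (fg_word (s a)) => [|e u] /=.
    by exists w.
  by exists (u ++ b a :: w).
have coverw h : (maxn M N + flen g0 <= flen h)%N -> exists a, D a (g0 * h).
  by move=> le_h; apply: cover; apply: leq_trans (flenM_ge _ _); lia.
have sg_surj d : exists a, sg a = d.
  have [|a /head_sg[w]] := coverw (ev (nseq (maxn M N + flen g0).+1 d)).
    by rewrite {2}/flen fg_word_ev ?size_nseq //; apply: reduced_nseq.
  rewrite fg_word_ev; last exact: (reduced_nseq d _.+1).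
  by case=> -> _; exists a.
have sg_inj : injective sg.
  have [r hr] := fin_all_exists sg_surj.
  exact: bij_inj (bij_can_bij (injF_bij (can_inj hr)) hr).
have s1 a : s a = 1.
  apply/eqP; rewrite -flen_eq0 size_eq0; apply/eqP.
  case e: (fg_word (s a)) => [//|d w].
  have [d' [n1 n2]] := letter_avoid2 hk (head (b a) w) (letterV d).
  pose n := (maxn M N + flen g0)%N.
  have rn : reduced (d :: nseq n.+1 d').
    rewrite -[_ :: _]/(rcons [::] d ++ d' :: nseq n d').
    by rewrite reduced_cat_cons //; apply: (reduced_nseq d' n.+1).
  have [|a' Da'] := coverw (ev (d :: nseq n.+1 d')).
    by rewrite {2}/flen fg_word_ev //= size_nseq -/n; lia.
  have ea : a' = a.
    apply: sg_inj; have [w'] := head_sg _ _ Da'; rewrite fg_word_ev //.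
    by case=> <- _; rewrite /sg e.
  move: Da'; rewrite ea => /prefixD[w']; rewrite fg_word_ev // e.
  case: w {e} n1 => [|d2 w] /= n1 [] e2; first by rewrite e2 eqxx in n1.
  by rewrite e2 eqxx in n1.
exists g0, b, M; split.
  move=> a a' e; apply: sg_inj.
  by rewrite /sg !s1.
move=> a g /hM ->; congr (starts _ (_^-1 * _)).
by rewrite -[t a](mulVKg g0) -/(s a) s1 mulg1.
Qed.

Lemma simple_aut_of_half_trees : simple_aut f'.
Proof.
have [t [s [M [s_inj hM]]]] := pulled_half_trees.
have key a : s (letterV a) = letterV (s a) /\
    f' (ev [:: a]) = t * ev [:: s a] * t^-1.
  set be := f' _.
  have compl g : (M + flen be <= flen g)%N ->
      starts (s (letterV a)) (t^-1 * g) = ~~ starts (s a) ((t^-1 * be) * g).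
    move=> le_g; rewrite -hM; last by lia.
    rewrite -mulgA -hM; last by apply: leq_trans (flenM_ge _ _); lia.
    by rewrite fM fK' -starts_compl mulKg.
  have d1 g : ~~ (starts (s (letterV a)) (t^-1 * g) &&
      starts (s a) ((t^-1 * be) * g)).
    move: g. apply: (half_trees_disjoint (M := (M + flen be)%N)) => g le_g.
    by rewrite compl // andNb.
  have d2 g : starts (s (letterV a)) (t^-1 * g) ||
      starts (s a) ((t^-1 * be) * g).
    rewrite -[X in X || _]negbK -[X in _ || X]negbK -negb_and -!starts_compl.
    rewrite !mulgA; move: g.
    apply: (half_trees_disjoint (M := (M + flen be)%N)) => g le_g.
    by rewrite -!mulgA !starts_compl mulgA compl // negbK andbN.
  have compl' (x : free_group k) :
      starts (s (letterV a)) x = ~~ starts (s a) ((t^-1 * be * t) * x).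
    have := d1 (t * x); have := d2 (t * x); rewrite mulKg mulgA.
    by case: (starts _ x); case: (starts _ _).
  pose z := (ev [:: s a])^-1 * (t^-1 * be * t).
  have compl2 (x : free_group k) : starts (s (letterV a)) x = starts (letterV (s a)) (z * x).
    by rewrite compl' -starts_compl mulgA.
  have st : starts (letterV (s a)) (z * ev [:: s (letterV a)]).
    by rewrite -compl2 starts_ev.
  have [|e1 e2] := @starts_exit _ (letterV (s (letterV a))) _ st.
    by rewrite ev_letterV mulgK -[z]mulg1 -compl2.
  have e3 : s (letterV a) = letterV (s a) by apply: (can_inj (@letterVK k)).
  split=> //; move: e1; rewrite e3 -[RHS]mul1g => /mulIg z1.
  have : t^-1 * be * t = ev [:: s a].
    by rewrite -[RHS]mulg1 -z1 mulVKg.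
  by move=> <-; rewrite !mulgA mulgV mul1g mulgK.
have f'M : {morph f' : g h / g * h}.
  by move=> g h; apply: (can_inj fK); rewrite fM !fK'.
exists t, (perm s_inj); split=> [a|g]; first by rewrite !permE; case: (key a).
rewrite -{1}(ev_fg_word g); elim: (fg_word g) => [|a w IHw] /=.
  by rewrite ev_nil (gmorph1 f'M) mulg1 mulgV.
rewrite ev_cons f'M IHw (ev_cons (perm s_inj a)) permE.
by case: (key a) => _ ->; rewrite -!mulgA mulKg.
Qed.

End StandardCuts.
End Rigidity.

(** * Turns of concatenations and inverses; powers *)

Lemma cat_prefix (T : Type) (s1 s2 t1 t2 : seq T) :
    s1 ++ s2 = t1 ++ t2 -> size t1 <= size s1 ->
  exists m, s1 = t1 ++ m /\ t2 = m ++ s2.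
Proof.
move=> e le; exists (drop (size t1) s1); split.
  rewrite -{1}(cat_take_drop (size t1) s1); congr (_ ++ _).
  by rewrite -(takel_cat s2) // e take_size_cat.
have := congr1 (drop (size t1)) e; rewrite [RHS]drop_size_cat // drop_cat => <-.
case: ltngtP le => // es _.
by rewrite es subnn drop0 drop_size.
Qed.

Section Turns.
Variable k : nat.
Implicit Types (a b d : letter k) (u v w x y z : seq (letter k)).
Implicit Types (g h t : free_group k).
Local Open Scope group_scope.

Lemma turns_cat_ge a b u v : (turns a b u + turns a b v <= turns a b (u ++ v))%N.
Proof.
elim: u => //= x u IHu; rewrite -addnA leq_add //.
by case: u {IHu} => //=; rewrite andbF.
Qed.

Lemma turns_cat_le a b u v : (turns a b (u ++ v) <= size u + turns a b v)%N.
Proof.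
by elim: u => //= x u IHu; rewrite addSn -add1n leq_add // leq_b1.
Qed.

Lemma turns_rcons2 a b w (y x : letter k) : turns a b (rcons (rcons w y) x) =
  (turns a b (rcons w y) + ((y == letterV a) && (x == b)))%N.
Proof.
elim: w => [|c w IHw] /=; first by rewrite !andbF !addn0.
have -> : ohead (rcons (rcons w y) x) = ohead (rcons w y) by case: (w).
by rewrite IHw addnA.
Qed.

Lemma turns_inv a b w : turns a b (word_inv w) = turns b a w.
Proof.
elim: w => [|x [|y w] IHw] //; first by rewrite /= !andbF.
rewrite word_inv_cons (word_inv_cons y) turns_rcons2 -(word_inv_cons y) IHw.
rewrite [in RHS]/= addnC; congr (_ + _)%N.
rewrite (inj_eq (can_inj (@letterVK k))) letterV_eq andbC.
by congr ((_ && _) : nat).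
Qed.

Lemma turns_cat_le_r a b u v :
  (turns a b (u ++ v) <= turns a b u + size v)%N.
Proof.
rewrite -turns_inv word_inv_cat (leq_trans (turns_cat_le _ _ _ _)) //.
by rewrite size_word_inv turns_inv addnC.
Qed.

Lemma turn2_cat_ge a b u v :
  (turn2 a b u + turn2 a b v <= turn2 a b (u ++ v))%N.
Proof. by rewrite /turn2 addnACA leq_add // turns_cat_ge. Qed.

Lemma turn2_infix a b u v w :
  (turn2 a b (u ++ v ++ w) <= turn2 a b v + 2 * (size u + size w))%N.
Proof.
have H c d : (turns c d (u ++ v ++ w) <= size u + (turns c d v + size w))%N.
  rewrite (leq_trans (turns_cat_le _ _ _ _)) // leq_add2l.
  exact: turns_cat_le_r.
by have := H a b; have := H b a; rewrite /turn2; lia.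
Qed.

Lemma turn2_inv a b w : turn2 a b (word_inv w) = turn2 a b w.
Proof. by rewrite /turn2 !turns_inv addnC. Qed.

Lemma reduced_glue u v w : 0 < size v ->
  reduced (u ++ v) -> reduced (v ++ w) -> reduced (u ++ v ++ w).
Proof.
case: v => // b v _; case/lastP: u => // u a ruv rvw.
have [ru _] := reduced_cat ruv; apply: reduced_cat_cons => //.
by move: ruv; rewrite -cat_rcons => /reduced_cat[/reduced_rcons2].
Qed.

Lemma cyclic_reduction g : g != 1 -> exists t w,
  [/\ g = t * ev w * t^-1, 0 < size w & reduced (w ++ w)].
Proof.
rewrite -flen_eq0; have [n] := ubnP (flen g); elim: n g => // n IHn g.
move=> ltn g0; have eg := ev_fg_word g; have := fg_wordP g.
move: ltn g0 eg; rewrite /flen; case: (fg_word g) => // a w ltn _ <- r.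
have [rr|nr] := boolP (reduced ((a :: w) ++ (a :: w))).
  by exists 1, (a :: w); split=> //; rewrite mul1g invg1 mulg1.
case/lastP: w ltn r nr => [|w b] ltn r nr.
  by move: nr; rewrite /reduced /= andbT eq_sym letterV_neq.
have eb : a = letterV b.
  apply/eqP/negPn/negP => ne; case/negP: nr.
  by rewrite -rcons_cons reduced_cat_cons.
have [_ rw] := reduced_cat (r : reduced ([:: a] ++ rcons w b)).
have [{}rw _] := reduced_cat (etrans (congr1 (@reduced k) (cats1 w b)) rw).
have fw : fg_word (ev w) = w by rewrite fg_word_ev.
have [||t [w' [e1 e2 e3]]] := IHn (ev w).
- by move: ltn; rewrite /flen fw /= size_rcons; lia.
- rewrite /flen fw; case: w r {ltn nr rw fw} => //=.
  by rewrite /reduced /= andbT eb letterVK eqxx.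
exists (ev [:: a] * t), w'; split=> //.
rewrite ev_cons ev_rcons e1 invgM -ev_letterV eb letterVK !mulgA.
by [].
Qed.

(** Nothing cancels between the factors of a power of a cyclically reduced word. *)
Lemma flen_expg_unbounded g n : g != 1 -> exists N, n <= flen (g ^+ N).
Proof.
move=> /cyclic_reduction[t [w [-> w0 r]]].
pose pw m := iter m (cat w) [::].
have epw m : (t * ev w * t^-1) ^+ m = t * ev (pw m) * t^-1.
  elim: m => [|m IHm]; first by rewrite ev_nil mulg1 mulgV.
  by rewrite expgS IHm /pw iterS ev_cat -!mulgA mulKg.
have rpw m : reduced (w ++ pw m).
  elim: m => [|m IHm]; last by rewrite /pw iterS reduced_glue.
  by rewrite cats0; case: (reduced_cat r).
have spw m : m <= size (pw m).
  by elim: m => // m IHm; rewrite /pw iterS size_cat -add1n leq_add.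
exists (n + flen t + flen t)%N; rewrite epw.
have fp : n + flen t + flen t <= flen (ev (pw (n + flen t + flen t)%N)).
  rewrite /flen fg_word_ev //.
  by case: (reduced_cat (rpw (n + flen t + flen t)%N)).
have := flenMr_ge (t * ev (pw (n + flen t + flen t)%N)) t^-1.
have := flenM_ge t (ev (pw (n + flen t + flen t)%N)).
by rewrite flenV; lia.
Qed.

End Turns.

(** * Small cancellation and malnormality *)

Section GeneratedSubgroup.
Variable G : groupType.
Local Open Scope group_scope.
Local Open Scope classical_set_scope.

Lemma group_closedP (B : set G) : group_closed [in B] <->
  B 1 /\ forall x y, B x -> B y -> B (x / y).
Proof.
have inB x : (x \in [in B]) = (x \in B) by [].
split=> -[B1 BV]; split; rewrite ?inB ?in_setE // in B1 *.
  move=> x y Bx By; have := BV x y; rewrite !inB !in_setE; exact.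
by move=> x y; rewrite !inB !in_setE; apply: BV.
Qed.

Lemma subgroup_gen_closed (A : set G) : let H := subgroup_gen A in
  [/\ H 1, forall x y, H x -> H y -> H (x * y) & forall x, H x -> H x^-1].
Proof.
move=> H; have H1 : H 1 by move=> B [/group_closedP[]].
have Hdiv x y : H x -> H y -> H (x / y).
  move=> Hx Hy B cB; have [/group_closedP[_ hB] _] := cB.
  by apply: hB; [apply: Hx | apply: Hy].
have HV x : H x -> H x^-1 by move=> Hx; rewrite -div1g; apply: Hdiv.
by split=> // x y Hx /HV Hy; rewrite -[y]invgK; apply: Hdiv.
Qed.

Lemma Aut_stab_malnormal (H : set G) : group_closed [in H] ->
  (exists2 x, H x & x <> 1) -> Aut_malnormal H -> Aut_stab H = Inn_by H.
Proof.
move=> /group_closedP[H1 Hdiv] [x Hx x1] mH; apply/seteqP; split=> f.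
  move=> [autf fH]; apply: mH => //; rewrite fH setIid => e.
  by apply: x1; move: Hx; rewrite e.
have HV y : H y -> H y^-1 by move=> Hy; rewrite -div1g; apply: Hdiv.
have HM y z : H y -> H z -> H (y * z).
  by move=> Hy /HV Hz; rewrite -[z]invgK; apply: Hdiv.
move=> [h Hh ->]; split.
  split; last by move=> y z; rewrite !mulgA mulgVK.
  exists (fun g => h^-1 * g * h) => g.
    by rewrite !mulgA mulVg mul1g mulgVK.
  by rewrite !mulgA mulgV mul1g mulgK.
apply/seteqP; split=> [_ [y Hy <-]|y Hy].
  exact: HM (HM _ _ Hh Hy) (HV _ Hh).
exists (h^-1 * y * h); first exact: HM (HM _ _ (HV _ Hh) Hy) Hh.
by rewrite !mulgA mulgV mul1g mulgK.
Qed.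

End GeneratedSubgroup.

Section SmallCancellation.
Variables k p r : nat.
Hypothesis hk : 2 <= k.
Variable ws : 'I_p -> free_group k.
Implicit Types (a b : letter k) (c d e : letter p) (g h t : free_group k).
Implicit Types (u v w x y z : seq (letter k)).
Local Open Scope group_scope.

Definition gen_word c := fg_word (letter_eval ws c).

Definition gen_subgroup : set (free_group k) :=
  subgroup_gen [set ws i | i in [set: 'I_p]]%classic.

(** With [s = 1] this is a classical small cancellation condition, which controls
    the subgroup; the other [s] exclude the automorphisms [simple_aut]. *)
Definition small_cancellation := forall s c d y x z y' z', signed_perm s ->
    gen_word c = y ++ x ++ z -> size x = r ->
    gen_word d = y' ++ map s x ++ z' ->
  [/\ s = 1, c = d & size y = size y'].

Let K := (k * (2 * k - 1))%N.

Definition long_generators := forall i,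
  (r * (2 * (2 * K + 1) * (4 * K + 1)) <= flen (ws i))%N.

(** There are [K] turns, so that their expected frequency is [1 / K], slightly more
    than [4 / (4 * K + 1)]. *)
Definition balanced_turns := forall i a b, a != b ->
  (4 * flen (ws i) <= (4 * K + 1) * turn2 a b (fg_word (ws i)))%N.

Hypotheses (r_gt0 : 0 < r) (sc : small_cancellation).
Hypotheses (long : long_generators) (balanced : balanced_turns).

Notation H := gen_subgroup.

Lemma gen_wordV c : gen_word (letterV c) = word_inv (gen_word c).
Proof.
rewrite /gen_word /letter_eval; case: c => i [] //=.
by rewrite ?fg_wordV word_invK.
Qed.

Lemma size_gen_word c : size (gen_word c) = flen (ws c.1).
Proof.
rewrite /gen_word /letter_eval; case: c => i [] //=.
by rewrite ?fg_wordV size_word_inv.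
Qed.

Lemma reduced_gen_word c : reduced (gen_word c). Proof. exact: fg_wordP. Qed.

Lemma gen_word_long c : (r * (2 * (2 * K + 1) * (4 * K + 1)) <= size (gen_word c))%N.
Proof. by rewrite size_gen_word. Qed.

Lemma gen_word_ge6r c : (6 * r <= size (gen_word c))%N.
Proof.
apply: leq_trans (gen_word_long c); rewrite mulnC leq_mul2l.
by rewrite /K; apply/orP; right; nia.
Qed.

Lemma gen_word_balanced c a b : a != b ->
  (4 * size (gen_word c) <= (4 * K + 1) * turn2 a b (gen_word c))%N.
Proof.
move=> ab; rewrite size_gen_word; have := balanced c.1 ab.
rewrite /gen_word /letter_eval; case: c => i [] //=.
by rewrite ?fg_wordV turn2_inv.
Qed.

Lemma gen_subgroup1 : H 1.
Proof. by case: (subgroup_gen_closed [set ws i | i in [set: 'I_p]]%classic). Qed.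

Lemma gen_subgroupM g h : H g -> H h -> H (g * h).
Proof.
by case: (subgroup_gen_closed [set ws i | i in [set: 'I_p]]%classic) => _ + _;
  apply.
Qed.

Lemma gen_subgroupV g : H g -> H g^-1.
Proof.
by case: (subgroup_gen_closed [set ws i | i in [set: 'I_p]]%classic) => _ _;
  apply.
Qed.

Lemma gen_subgroupX g n : H g -> H (g ^+ n).
Proof.
move=> Hg; elim: n => [|n IHn]; first exact: gen_subgroup1.
by rewrite expgS; apply: gen_subgroupM.
Qed.

Lemma gen_subgroup_gen i : H (ws i).
Proof. by apply: sub_gen_smallest; exists i. Qed.

Lemma gen_subgroup_letter c : H (letter_eval ws c).
Proof.
rewrite /letter_eval; case: ifP => _; first exact: gen_subgroup_gen.
by apply: gen_subgroupV; apply: gen_subgroup_gen.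
Qed.

Lemma gen_subgroup_reduced_word g : H g ->
  exists2 l : seq (letter p), reduced l & g = word_eval ws l.
Proof.
have [f [[fM fi] _]] := free_group_universal ws.
have fE (l : free_group p) : f l = word_eval ws (fg_word l).
  rewrite -{1}(word_eval_basis l) /word_eval (big_morph f fM (gmorph1 fM)).
  apply: eq_bigr => -[i c] _; rewrite /letter_eval /=.
  by case: c; rewrite ?(gmorphV fM) fi.
suff sub : (H `<=` [set f l | l in [set: free_group p]])%classic.
  by move=> /sub[l _ <-]; exists (fg_word l); rewrite ?fg_wordP ?fE.
apply: smallest_sub; last by move=> _ [i _ <-]; exists (fg_basis i).
apply/group_closedP; split; first by exists 1; rewrite ?(gmorph1 fM).
move=> _ _ [l _ <-] [l' _ <-]; exists (l / l') => //.
by rewrite fM (gmorphV fM).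
Qed.

(** Trace left by a product of generators on its reduced word [w], read from the
    vertex [g]: of each generator there remains a large piece [z], and
    [g * (ev y)^-1] is the vertex at which this generator started before
    cancellation. *)
Inductive chain : free_group k -> seq (letter k) -> Prop :=
| chain_nil g : chain g [::]
| chain_cons g z w c y y' : gen_word c = y ++ z ++ y' ->
    size y <= r -> size y' <= r -> H (g * (ev y)^-1) ->
    chain (g * ev z) w -> chain g (z ++ w).

Lemma signed_perm1 : signed_perm (1 : {perm letter k}).
Proof. by move=> a; rewrite !perm1. Qed.

Lemma map_perm1 x : map (1 : {perm letter k}) x = x.
Proof. by rewrite -[RHS]map_id; apply: eq_map => a; rewrite perm1. Qed.

Lemma gen_words_prefix c d x y y' : size x = r ->
  gen_word c = x ++ y -> gen_word d = x ++ y' -> c = d.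
Proof.
move=> sx e1 e2.
have [] // := @sc 1 c d [::] x y [::] y' signed_perm1 e1 sx.
by rewrite map_perm1.
Qed.

(** Consecutive generators cancel along fewer than [r] letters, since a longer
    cancellation is a common prefix of two of the words [gen_word]. *)
Lemma chain_build l c : reduced (c :: l) -> exists z y w,
  [/\ gen_word c = z ++ y, size y <= r,
      fg_word (word_eval ws (c :: l)) = z ++ w &
      forall g, H g -> chain (g * ev z) w].
Proof.
elim: l c => [|d l IHl] c rl.
  exists (gen_word c), [::], [::]; rewrite !cats0 /word_eval big_seq1.
  by split=> // g _; apply: chain_nil.
have rl' : reduced (d :: l) by exact: reduced_cons rl.
have [z [y [w [ed sy ew hw]]]] := IHl d rl'.
have dc : d != letterV c by move: rl; rewrite /reduced /= => /andP[].
rewrite /word_eval big_cons fg_wordM [X in word_mul _ (fg_word X)]/=.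
rewrite -[X in word_mul _ (fg_word X)]/(word_eval ws (d :: l)) ew.
have [z1 [t [z2 [e1 e2 e3]]]] := word_mul_cancel (z ++ w) (reduced_gen_word c).
have rz : r <= size z.
  by have := gen_word_ge6r d; rewrite ed size_cat; lia.
have tr : size t < r.
  rewrite ltnNge; apply/negP => rt; case/eqP: dc.
  have ez : take r t = take r z.
    by rewrite -(takel_cat w rz) e2 takel_cat.
  apply/esym; apply: (@gen_words_prefix _ _ (take r t)
    (drop r t ++ word_inv z1) (drop r z ++ y)).
  - by rewrite size_takel.
  - by rewrite gen_wordV e1 word_inv_cat word_invK catA cat_take_drop.
  - by rewrite ez catA cat_take_drop.
have [m [em ez2]] := cat_prefix e2 (leq_trans (ltnW tr) rz).
exists z1, (word_inv t), (m ++ w); split=> //.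
- by rewrite size_word_inv ltnW.
- by rewrite e3 ez2.
have egc : letter_eval ws c = ev z1 * (ev t)^-1.
  by rewrite -(ev_fg_word (letter_eval ws c)) -ev_word_inv -ev_cat -e1.
move=> g Hg; apply: (@chain_cons _ m w d t y).
- by rewrite ed em -catA.
- exact: ltnW.
- exact: sy.
- by rewrite -mulgA -egc; apply: gen_subgroupM => //; apply: gen_subgroup_letter.
have -> : g * ev z1 * ev m = g * letter_eval ws c * ev z.
  by rewrite egc em ev_cat -!mulgA mulKg.
by apply: hw; apply: gen_subgroupM => //; apply: gen_subgroup_letter.
Qed.

Lemma chain_gen_subgroup g : H g -> chain 1 (fg_word g).
Proof.
move=> /gen_subgroup_reduced_word[[|c l] rl ->].
  by rewrite /word_eval big_nil; apply: chain_nil.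
have [z [y [w [ec sy -> hw]]]] := chain_build rl.
apply: (@chain_cons _ _ _ c [::] y) => //.
  by rewrite ev_nil mulgV; apply: gen_subgroup1.
by apply: hw; apply: gen_subgroup1.
Qed.

Lemma chain_balanced g w a b : a != b -> chain g w ->
  (2 * size w <= (2 * K + 1) * turn2 a b w)%N.
Proof.
move=> ab; elim=> {g w} [//|g z w c y y' ec sy sy' _ _ IH].
suff hz : (2 * size z <= (2 * K + 1) * turn2 a b z)%N.
  apply: leq_trans (leq_mul (leqnn _) (turn2_cat_ge a b z w)).
  rewrite size_cat mulnDr [leqRHS]mulnDr. by apply: leq_add.
(* Passing from the generator to its piece removes at most [4 * r] turns, which is
   small with respect to its length; hence [2 / (2 * K + 1)] instead of
   [4 / (4 * K + 1)]. *)
have := gen_word_balanced c ab; have := gen_word_long c.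
rewrite ec; have := turn2_infix a b y z y'.
move: (turn2 _ _ (_ ++ _)) => T; rewrite !size_cat => h1 h2 h3.
have : (2 * (size y + (size z + size y')) * (4 * K + 1) <=
  (2 * K + 1) * turn2 a b z * (4 * K + 1))%N by nia.
rewrite leq_mul2r addn_eq0 andbF /= => h4.
apply: leq_trans h4; lia.
Qed.

Lemma gen_subgroup_balanced g a b : H g -> a != b ->
  (2 * flen g <= (2 * K + 1) * turn2 a b (fg_word g))%N.
Proof. by move=> Hg ab; apply: chain_balanced (chain_gen_subgroup Hg). Qed.

(** As the pieces have length at least [n], a window of length [2 * n] meets two of
    them at most, or contains one. *)
Lemma chain_locate n g w : 0 < n <= 2 * r -> chain g w ->
  forall u m v, w = u ++ m ++ v -> 2 * n <= size m ->
  exists m1 x m2 c y y', [/\ m = m1 ++ x ++ m2, size x = n,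
    gen_word c = y ++ x ++ y' & H (g * ev u * ev m1 * (ev y)^-1)].
Proof.
move=> /andP[n0 le_n]; elim=> {g w} [g|g z w c y y' ec sy sy' Hg cw IH] u m v.
  move=> e le_m; have : size (u ++ m ++ v) = 0%N by rewrite -e.
  by rewrite !size_cat; lia.
move=> e le_m; have [le_uz|lt_zu] := leqP (size z) (size u).
  have [u' [eu ew]] := cat_prefix (esym e) le_uz.
  have [m1 [x [m2 [d [y1 [y2 [h1 h2 h3 h4]]]]]]] := IH u' m v ew le_m.
  exists m1, x, m2, d, y1, y2; split=> //.
  by rewrite eu ev_cat !mulgA.
have [z2 [ez emv]] := cat_prefix e (ltnW lt_zu).
have [le_nz|lt_zn] := leqP n (size z2).
  have tn : take n m = take n z2.
    rewrite -(takel_cat v); last by lia.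
    by rewrite emv takel_cat.
  exists [::], (take n z2), (drop n m), c, (y ++ u), (drop n z2 ++ y').
  rewrite size_takel //; split=> //.
  - by rewrite -tn /= cat_take_drop.
  - by rewrite ec ez !catA -(catA _ (take n z2)) cat_take_drop.
  - by rewrite ev_nil mulg1 ev_cat invgM !mulgA mulgK.
have le_zm : size z2 <= size m by lia.
have [m' [em' ew]] := cat_prefix emv le_zm.
have := congr1 size em'; rewrite size_cat => sm.
have [h eh] : exists h, h = g * ev z by exists (g * ev z).
rewrite -eh in cw; case: cw eh ew {IH} => [h0 _ ew|].
  by have : (size m' + size v = 0)%N; [rewrite -size_cat -ew | lia].
move=> {}h z' w' d y1 y1' ed sy1 sy1' Hh _ eh ew.
have le_nz' : n <= size z'.
  by have := gen_word_ge6r d; rewrite ed !size_cat; lia.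
have tn : take n m' = take n z'.
  rewrite -(takel_cat v); last by lia.
  by rewrite -ew takel_cat.
exists z2, (take n z'), (drop n m'), d, y1, (drop n z' ++ y1').
rewrite size_takel //; split=> //.
- by rewrite em' -tn cat_take_drop.
- by rewrite ed -{1}(cat_take_drop n z') -catA.
- by rewrite -(mulgA g) -ev_cat -ez -eh.
Qed.

(** An automorphism permuting the letters up to conjugation: applied to a long
    element of the subgroup it yields two occurrences of the same word in the
    generators, so that the permutation is trivial and the conjugating element
    maps a vertex of the subgroup to a vertex of the subgroup. *)
Lemma simple_aut_malnormal (f : free_group k -> free_group k) (x : free_group k) :
    simple_aut f -> {morph f : g h / g * h} ->
    x != 1 -> H x -> H (f x) ->
  exists2 t, H t & forall g, f g = t * g * t^-1.
Proof.
move=> [t [s [sV fE]]] fM x1 Hx Hfx.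
have [N hN] := flen_expg_unbounded (2 * flen t + 4 * r) x1.
set u := x ^+ N in hN; have Hu : H u by apply: gen_subgroupX.
have Hfu : H (f u) by rewrite gmorphX //; apply: gen_subgroupX.
pose w0 := take (flen t) (fg_word u).
pose m0 := take (4 * r) (drop (flen t) (fg_word u)).
pose v0 := drop (4 * r) (drop (flen t) (fg_word u)).
have ew : fg_word u = w0 ++ m0 ++ v0 by rewrite !cat_take_drop.
have sw0 : size w0 = flen t by rewrite size_takel // -/(flen u); lia.
have sm0 : size m0 = (4 * r)%N.
  by rewrite size_takel // size_drop -/(flen u); lia.
have sv0 : flen t <= size v0 by rewrite !size_drop -/(flen u); lia.
have [||m1 [z [m2 [c [y [y' [em sz ec Hh]]]]]]] :=
  @chain_locate (2 * r) 1 _ _ (chain_gen_subgroup Hu) w0 m0 v0 ew _.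
- by rewrite leqnn; lia.
- by rewrite sm0; lia.
have rs : reduced (map s w0 ++ map s m0 ++ map s v0).
  rewrite -!map_cat -ew; have := fg_wordP u; rewrite /reduced sorted_map.
  by apply: sub_sorted => a b /=; rewrite -sV (inj_eq perm_inj).
have sw0' : flen t <= size (map s w0) by rewrite size_map sw0.
have sv0' : flen t <= size (map s v0) by rewrite size_map.
have [q [v [efu eq]]] := word_conj_middle rs sw0' sv0'.
rewrite -!map_cat -ew -fE em !map_cat in efu.
have efu' : fg_word (f u) = (q ++ map s m1) ++ map s z ++ (map s m2 ++ v).
  by rewrite efu -!catA.
have [||n1 [x' [n2 [d [y2 [y2' [en sx' ed Hh']]]]]]] :=
  @chain_locate r 1 _ _ (chain_gen_subgroup Hfu) _ _ _ efu' _.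
- by rewrite r_gt0; lia.
- by rewrite size_map sz.
pose x1' := take (size n1) z; pose z' := drop (size n1) z.
pose x2 := take r z'; pose x3 := drop r z'.
have ez : z = x1' ++ x2 ++ x3 by rewrite !cat_take_drop.
have sn : (size n1 + (size x' + size n2))%N = size z.
  by rewrite -(size_map s z) en !size_cat.
have e1 : map s x1' = n1 by rewrite map_take en take_size_cat.
have e2 : map s x2 = x'.
  by rewrite map_take map_drop en drop_size_cat // take_size_cat.
have [|||es ecd ey] := @sc s c d (y ++ x1') x2 (x3 ++ y') y2 y2' sV.
- by rewrite ec ez -!catA.
- by rewrite size_takel // size_drop; lia.
- by rewrite e2.
have ey2 : y ++ x1' = y2.
  have : gen_word c = y2 ++ (x' ++ y2') by rewrite ecd.
  rewrite ec ez -!catA catA => /eqP; rewrite eqseq_cat // => /andP[/eqP].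
  by [].
have en1 : n1 = x1' by rewrite -e1 es map_perm1.
exists t; last first.
  by move=> g; rewrite fE es map_perm1 ev_fg_word.
have eq' : ev q = t * ev w0 by rewrite eq es map_perm1.
move: Hh'; rewrite es map_perm1 mul1g ev_cat eq' en1 -ey2 ev_cat => Hh'.
set h := 1 * _ * _ * _ in Hh.
suff -> : t = t * ev w0 * ev m1 * ev x1' * (ev y * ev x1')^-1 * h^-1.
  by apply: gen_subgroupM => //; apply: gen_subgroupV.
by rewrite /h mul1g !invgM invgK !mulgA !(mulgK, mulgVK).
Qed.

(** On the subgroup, each turn has frequency at least [2 / (2 * K + 1)], so that
    [length_gain] multiplies lengths by at least [(2 * K + 2) / (2 * K + 1)]. *)
Lemma gen_subgroup_length_gain (f f' : free_group k -> free_group k) :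
    {morph f : g h / g * h} -> cancel f f' -> cancel f' f -> ~ simple_aut f' ->
  exists C, forall g, H g ->
    ((2 * K + 2) * flen g <= (2 * K + 1) * flen (f g) + C)%N.
Proof.
move=> fM fK fK' nf'.
have [|C hC] := length_gain fM fK fK' hk.
  apply: contrapT => n; apply: nf'; apply: (simple_aut_of_half_trees hk fM fK fK').
  by move=> i; apply: contrapT => ni; apply: n; exists i.
exists ((2 * K + 1) * C)%N => g Hg.
(* The least integer allowed by the frequencies. *)
pose m := ((2 * flen g + 2 * K) %/ (2 * K + 1))%N.
have m_ge : (2 * flen g <= (2 * K + 1) * m)%N.
  have : 0 < 2 * K + 1 by rewrite addn1.
  move=> /(ltn_pmod (2 * flen g + 2 * K)).
  have := divn_eq (2 * flen g + 2 * K) (2 * K + 1); rewrite -/m; lia.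
have m_le a b : a != b -> m <= turn2 a b (fg_word g).
  move=> ab; have := gen_subgroup_balanced Hg ab => h.
  rewrite -ltnS ltn_divLR ?addn1 // mulSn; nia.
have := hC g m m_le; rewrite -/K; nia.
Qed.

(** If neither [f] nor its inverse is simple, both lengthen the long elements of the
    subgroup, whereas the powers of [x] and [f x] stay in it. *)
Lemma gen_subgroup_malnormal : Aut_malnormal H.
Proof.
move=> f [[f' fK fK'] fM] fH.
have f'M : {morph f' : g h / g * h}.
  by move=> g h; apply: (can_inj fK); rewrite fM !fK'.
have [x [x1 Hx Hfx]] : exists x : free_group k, [/\ x != 1, H x & H (f x)].
  apply: contrapT => nx; apply: fH; apply/seteqP; split=> [_ [[x Hx <-] Hfx]|_ ->].
    have [->|x1] := eqVneq x 1; first exact: gmorph1.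
    by case: nx; exists x.
  by split; [exists 1; rewrite ?gmorph1 //|]; apply: gen_subgroup1.
have [sf|nf] := pselect (simple_aut f).
  have [t Ht ft] := simple_aut_malnormal sf fM x1 Hx Hfx.
  by exists t => //; apply/funext.
have [sf'|nf'] := pselect (simple_aut f').
  have fx1 : f x != 1 by apply: contra x1 => /eqP e; rewrite -(fK x) e gmorph1.
  have [|t Ht ft] := simple_aut_malnormal sf' f'M fx1 Hfx; first by rewrite fK.
  exists t^-1; first exact: gen_subgroupV.
  apply/funext => g; apply: (can_inj fK'); rewrite fK ft invgK.
  by rewrite !mulgA mulgV mul1g mulgK.
have [C hC] := gen_subgroup_length_gain fM fK fK' nf'.
have [C' hC'] := gen_subgroup_length_gain f'M fK' fK nf.
have [N hN] := flen_expg_unbounded (C + C').+1 x1.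
have := hC _ (gen_subgroupX N Hx).
have := hC' (f (x ^+ N)); rewrite fK gmorphX // => /(_ (gen_subgroupX N Hfx)).
nia.
Qed.

Lemma gen_subgroup_nontrivial (i : 'I_p) : exists2 x, H x & x <> 1.
Proof.
exists (ws i); first exact: gen_subgroup_gen.
move=> e; have := long i; rewrite e flen1; nia.
Qed.

End SmallCancellation.

(** * Exponentially small sequences *)

Section ExpSmall.
Variable R : realType.
Implicit Types (u v : nat -> R) (rho : R).
Local Open Scope ring_scope.

Definition exp_small u := exists C rho,
  [/\ 0 < C, 0 < rho, rho < 1 & forall n, u n <= C * rho ^+ n].

Lemma bernoulli (x : R) n : -1 <= x -> 1 + n%:R * x <= (1 + x) ^+ n.
Proof.
move=> x1; elim: n => [|n IHn]; first by rewrite mul0r addr0 expr0.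
rewrite exprS; apply: (@le_trans _ _ ((1 + x) * (1 + n%:R * x))); last first.
  by apply: ler_wpM2l => //; lra.
by rewrite -natr1; have : 0 <= n%:R * (x * x) by [rewrite mulr_ge0 // -expr2 sqr_ge0]; nra.
Qed.

Lemma exp_small_le u v : (forall n, u n <= v n) -> exp_small v -> exp_small u.
Proof.
move=> uv [C [rho [C0 r0 r1 h]]]; exists C, rho; split=> // n.
exact: le_trans (uv n) (h n).
Qed.

Lemma exp_small_geom C rho : 0 <= rho -> rho < 1 ->
  exp_small (fun n => C * rho ^+ n).
Proof.
move=> r0 r1; exists (`|C| + 1), ((1 + rho) / 2); split=> [|||n]; try lra.
  by have := normr_ge0 C; lra.
have h : rho ^+ n <= ((1 + rho) / 2) ^+ n by apply: lerXn2r; rewrite ?nnegrE; lra.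
have h0 : 0 <= rho ^+ n by apply: exprn_ge0.
by have := ler_norm C; have := normr_ge0 C; nra.
Qed.

Lemma exp_smallD u v : exp_small u -> exp_small v ->
  exp_small (fun n => u n + v n).
Proof.
move=> [C [rho [C0 r0 r1 h]]] [C' [rho' [C0' r0' r1' h']]].
exists (C + C'), (Num.max rho rho'); split.
- by rewrite addr_gt0.
- by rewrite lt_max r0.
- by rewrite gt_max r1.
move=> n; rewrite mulrDl; apply: lerD.
  apply: le_trans (h n) _; apply: ler_wpM2l; first exact: ltW.
  by apply: lerXn2r; rewrite ?nnegrE ?le_max ?lexx ?(ltW r0).
apply: le_trans (h' n) _; apply: ler_wpM2l; first exact: ltW.
by apply: lerXn2r; rewrite ?nnegrE ?le_max ?lexx ?(ltW r0') ?orbT.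
Qed.

Lemma exp_smallZ c u : 0 <= c -> exp_small u -> exp_small (fun n => c * u n).
Proof.
move=> c0 [C [rho [C0 r0 r1 h]]]; exists (c * C + 1), rho; split=> //.
  by have := mulr_ge0 c0 (ltW C0); lra.
move=> n; have := ler_wpM2l c0 (h n); have : 0 <= rho ^+ n by apply/exprn_ge0/ltW.
by rewrite mulrDl mul1r mulrA; lra.
Qed.

(** Union bounds over positions in words cost factors [n.+1]. *)
Lemma exp_small_mulSn u : exp_small u -> exp_small (fun n => n.+1%:R * u n).
Proof.
move=> [C [rho [C0 r0 r1 h]]].
pose rho' := (1 + rho) / 2; pose d := rho' / rho - 1.
have d0 : 0 < d by rewrite /d subr_gt0 ltr_pdivlMr // mul1r /rho'; lra.
have er : rho' = rho * (1 + d).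
  by rewrite /d addrC subrK mulrC divfK // gt_eqF.
exists (C * (1 + d^-1)), rho'; split; rewrite ?/rho'; try lra.
  by rewrite mulr_gt0 // addr_gt0 // invr_gt0.
move=> n; apply: (@le_trans _ _ (n.+1%:R * (C * rho ^+ n))).
  by apply: ler_wpM2l.
rewrite -/rho' er exprMn mulrACA mulrC ler_wpM2l //.
  by rewrite mulr_ge0 ?exprn_ge0 // ltW.
have := @bernoulli d n; move=> /(_ ltac:(lra)) hb.
have dv : 0 < d^-1 by rewrite invr_gt0.
apply: (@le_trans _ _ ((1 + d^-1) * (1 + n%:R * d))); last first.
  by apply: ler_wpM2l => //; lra.
have -> : (1 + d^-1) * (1 + n%:R * d) = 1 + n%:R * d + d^-1 + n%:R * (d^-1 * d).
  by lra.
rewrite mulVf ?gt_eqF // mulr1 -natr1.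
by have : 0 <= n%:R * d by [rewrite mulr_ge0 // ltW]; lra.
Qed.

Lemma exp_small_divn D u : (0 < D)%N -> exp_small u ->
  exp_small (fun n => u (n %/ D)%N).
Proof.
move=> D0 [C [rho [C0 r0 r1 h]]].
pose rho' := 1 - (1 - rho) / D%:R.
have D1 : 1 <= D%:R :> R by rewrite ler1n.
have e0 : 0 < (1 - rho) / D%:R by rewrite divr_gt0 ?ltr0n //; lra.
have e1 : (1 - rho) / D%:R <= 1 - rho.
  by rewrite ler_pdivrMr ?ltr0n //; nra.
have hr : rho <= rho' ^+ D.
  have := @bernoulli (- ((1 - rho) / D%:R)) D.
  rewrite mulrN mulrCA divff ?pnatr_eq0 -?lt0n // mulr1 => /(_ ltac:(lra)).
  by rewrite /rho'; lra.
have r0' : 0 < rho' by rewrite /rho'; lra.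
have r1' : rho' < 1 by rewrite /rho'; lra.
exists (C / rho), rho'; split=> //; first exact: divr_gt0.
move=> n; apply: le_trans (h _) _; rewrite -mulrA ler_pM2l //.
rewrite ler_pdivlMl // -exprS.
apply: (@le_trans _ _ ((rho' ^+ D) ^+ (n %/ D).+1)).
  by apply: lerXn2r => //; rewrite nnegrE; [exact: ltW | exact/exprn_ge0/ltW].
rewrite -exprM ler_wiXn2l ?(ltW r0') ?(ltW r1') //.
by rewrite mulnC ltnW // ltn_ceil.
Qed.

Lemma exp_small_eventually N u v : (forall n, u n <= 1) ->
  (forall n, (N <= n)%N -> u n <= v n) -> exp_small v -> exp_small u.
Proof.
move=> u1 uv [C [rho [C0 r0 r1 h]]].
exists (C + rho ^- N), rho; split=> //.
  by rewrite addr_gt0 // invr_gt0 exprn_gt0.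
move=> n; rewrite mulrDl; have rn m : 0 < rho ^+ m by apply: exprn_gt0.
have [le_n|lt_n] := leqP N n.
  apply: le_trans (uv n le_n) _; apply: le_trans (h n) _.
  by rewrite lerDl mulr_ge0 // ?invr_ge0 ltW.
apply: le_trans (u1 n) _; apply: (@le_trans _ _ (rho ^- N * rho ^+ n)).
  by rewrite ler_pdivlMl // mulr1 ler_wiXn2l ?(ltW r0) ?(ltW r1) // ltnW.
by rewrite lerDr mulr_ge0 // ltW.
Qed.

Lemma exp_generic_small k p (E : forall n, set (walks k p n)) :
  exp_small (fun n => walk_prob R (~` E n)%classic) -> exp_generic R E.
Proof.
move=> [C [rho [C0 r0 r1 h]]]; exists C, rho^-1; split=> //.
  by rewrite invf_gt1.
by move=> n; rewrite exprVn invrK.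
Qed.

End ExpSmall.

(** * Hitting probabilities of the simple random walk *)

Section Walk.
Variable R : realType.
Variable k : nat.
Implicit Types (a b : letter k) (v w : seq (letter k)).
Local Open Scope ring_scope.

Fixpoint rwords (l : nat) : seq (seq (letter k)) :=
  if l is m.+1 then
    [seq a :: v | v <- rwords m, a <- enum [pred a | reduced (a :: v)]]
  else [:: [::]].

Lemma mem_rwords l v : (v \in rwords l) = reduced v && (size v == l).
Proof.
elim: l v => [|l IHl] [|a v] //=; rewrite ?andbF //.
  by apply/allpairsPdep => -[? [? []]].
apply/allpairsPdep/andP => [[w [b [hw hb [-> ->]]]]|[r /eqP[s]]].
  by move: hb hw; rewrite mem_enum inE IHl => ? /andP[_]; rewrite eqSS.
exists v, a; split=> //; last by rewrite mem_enum inE.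
by rewrite IHl s eqxx andbT (reduced_cons r).
Qed.

Lemma sum_rwordsS l (F : seq (letter k) -> R) :
  \sum_(v <- rwords l.+1) F v =
  \sum_(v <- rwords l) \sum_(a | reduced (a :: v)) F (a :: v).
Proof.
by rewrite /= big_allpairs_dep; apply: eq_bigr => v _; rewrite big_enum.
Qed.

Lemma sum_tupleS (T : finType) n (F : n.+1.-tuple T -> R) :
  \sum_t F t = \sum_a \sum_(t : n.-tuple T) F (cons_tuple a t).
Proof.
rewrite pair_big (reindex (fun q : T * n.-tuple T => cons_tuple q.1 q.2)) //=.
exists (fun t => (thead t, behead_tuple t)) => [[a t] _|t _] /=.
  by congr (_, _); apply: val_inj.
by rewrite [RHS]tuple_eta; apply: val_inj.
Qed.

Lemma card_letters_ext a v :
  #|[pred b | reduced (b :: a :: v)]| = (reduced (a :: v) * (2 * k).-1)%N.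
Proof.
rewrite -card_letter; case r: (reduced (a :: v)).
  rewrite mul1n -(cardC1 (letterV a)); apply: eq_card => b.
  rewrite !inE; move: r; rewrite /reduced /= => ->.
  by rewrite andbT eq_sym letterV_eq eq_sym.
rewrite mul0n; apply: eq_card0 => b; rewrite inE.
by apply/negP => /reduced_cons; rewrite r.
Qed.

Definition hits n v : R := \sum_(t : n.-tuple (letter k))
  (word_mul t [::] == v)%:R.

Lemma push_eq a v w : reduced v -> reduced w ->
  (push a v == w) = (v == push (letterV a) w).
Proof.
by move=> rv rw; apply/eqP/eqP => [<-|->]; rewrite ?pushVK ?pushKV.
Qed.

Lemma hitsS n v : reduced v ->
  hits n.+1 v = \sum_a hits n (push (letterV a) v).
Proof.
move=> rv; rewrite /hits sum_tupleS; apply: eq_bigr => a _.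
by apply: eq_bigr => t _; rewrite /= push_eq // reduced_mul.
Qed.

(** Supersolutions of the equation satisfied by the transition probabilities
    dominate them. *)
Lemma hits_le (x la : R) n v : 0 < x -> x <= la ->
    x^-1 + (2 * k).-1%:R * x <= (2 * k)%:R * la -> (0 < k)%N -> reduced v ->
  hits n v <= ((2 * k)%:R * la) ^+ n * x ^+ size v.
Proof.
move=> x0 xla hx k0; elim: n v => [|n IHn] v rv.
  rewrite expr0 mul1r /hits (bigD1 [tuple]) //= big1 => [|t]; last first.
    by rewrite tuple0.
  case: v rv => [|a v] _; first by rewrite eqxx addr0.
  by rewrite addr0; apply/exprn_ge0/ltW.
have la0 : 0 < la by apply: lt_le_trans xla.
have C0 : 0 <= ((2 * k)%:R * la) ^+ n by rewrite exprn_ge0 // mulr_ge0 // ltW.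
rewrite hitsS // exprSr -mulrA.
case: v rv => [|b v] rv.
  rewrite /= expr0 mulr1; apply: (@le_trans _ _ (\sum_(a : letter k)
    ((2 * k)%:R * la) ^+ n * x)).
    by apply: ler_sum => a _; have := IHn [:: letterV a] isT; rewrite expr1.
  by rewrite sumr_const card_letter -mulrnAr ler_wpM2l // -mulr_natl ler_wpM2l.
rewrite (bigD1 b) //=; apply: (@le_trans _ _ (((2 * k)%:R * la) ^+ n *
  x ^+ size v + \sum_(a | a != b) ((2 * k)%:R * la) ^+ n * x ^+ (size v).+2)).
  apply: lerD; first by rewrite letterVK eqxx; apply/IHn/(reduced_cons rv).
  apply: ler_sum => a ab; rewrite letterVK eq_sym (negbTE ab).
  apply: (IHn [:: letterV a, b & v]); rewrite /reduced /= letterVK eq_sym ab.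
  exact: rv.
rewrite sumr_const cardC1 card_letter -mulrnAr -mulrDr ler_wpM2l //.
have xs : 0 < x ^+ (size v).+1 by apply: exprn_gt0.
have -> : x ^+ size v = x ^+ (size v).+1 * x^-1.
  by rewrite exprSr mulfK // gt_eqF.
rewrite -mulr_natl [x ^+ (size v).+2]exprSr /=.
by have := ler_wpM2r (ltW xs) hx; lra.
Qed.

Definition walk_freq n (Q : pred (seq (letter k))) : R :=
  (\sum_(t : n.-tuple (letter k)) (Q (word_mul t [::]))%:R) / (2 * k)%:R ^+ n.

Lemma sum_walks_le n (Q : pred (seq (letter k))) :
  \sum_(t : n.-tuple (letter k)) (Q (word_mul t [::]))%:R <=
  \sum_(l < n.+1) \sum_(v <- rwords l) (Q v)%:R * hits n v.
Proof.
under [leRHS]eq_bigr => l _.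
  under eq_bigr => v _ do rewrite /hits mulr_sumr.
  rewrite exchange_big /=; over.
rewrite exchange_big /=; apply: ler_sum => t _; set v := word_mul t [::].
have rv : reduced v by apply: reduced_mul.
have sv : (size v < n.+1)%N.
  have := flen_ev t; rewrite /flen fg_word_walk size_tuple -/v.
  by rewrite ltnS.
rewrite (bigD1 (Ordinal sv)) //= (big_rem v) /=; last by rewrite mem_rwords rv eqxx.
rewrite eqxx mulr1 -addrA lerDl addr_ge0 //.
  by apply: sumr_ge0 => w _; rewrite mulr_ge0.
by apply: sumr_ge0 => l _; apply: sumr_ge0 => w _; rewrite mulr_ge0.
Qed.

(** The supersolution of parameter [1 / q], with [q = 2 * k - 1], dominates the law
    of the endpoint by the measure of weight [1 / q ^ l] on the words of length
    [l]; events on random walks are thus reduced to counting reduced words. *)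
Lemma walk_freq_le n Q : (0 < k)%N ->
  walk_freq n Q <= \sum_(l < n.+1)
    ((2 * k).-1%:R ^- l * \sum_(v <- rwords l) (Q v)%:R).
Proof.
move=> k0; have q0 : 0 < (2 * k).-1%:R :> R by rewrite ltr0n; lia.
rewrite /walk_freq ler_pdivrMr ?exprn_gt0 ?ltr0n ?muln_gt0 //.
apply: le_trans (sum_walks_le _ _) _; rewrite mulr_suml; apply: ler_sum => l _.
rewrite mulr_sumr mulr_suml; rewrite big_seq [leRHS]big_seq.
apply: ler_sum => v; rewrite mem_rwords => /andP[rv /eqP<-].
rewrite [leRHS]mulrAC mulrC ler_wpM2r // -exprVn [leRHS]mulrC.
rewrite -[(2 * k)%:R]mulr1; apply: hits_le => //; rewrite ?invr_gt0 //.
  by rewrite invf_le1 // ler1n; lia.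
by rewrite invrK divff ?gt_eqF // mulr1 natr1 prednK // muln_gt0.
Qed.

Lemma sum_rwords1_le l : (0 < k)%N ->
  \sum_(v <- rwords l) 1 <= (2 * k)%:R ^+ l :> R.
Proof.
move=> k0; elim: l => [|l IHl]; first by rewrite big_seq1.
rewrite sum_rwordsS exprSr; apply: le_trans (ler_wpM2r _ IHl) => //.
rewrite mulr_suml; apply: ler_sum => v _; rewrite sumr_const mul1r.
by rewrite ler_nat -card_letter max_card.
Qed.

(** Comparison with the supersolution of parameter [1 / 2]: the walk leaves the
    origin at a positive speed. *)
Lemma walk_freq_short n L : (2 <= k)%N ->
  walk_freq n (fun v => size v < L)%N <= (7%:R / 8%:R) ^+ n * (L%:R * k%:R ^+ L).
Proof.
move=> k2; have k0 : (0 < k)%N by lia.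
have k2R : 2 <= k%:R :> R by rewrite ler_nat.
rewrite /walk_freq ler_pdivrMr ?exprn_gt0 ?ltr0n ?muln_gt0 //.
apply: le_trans (sum_walks_le n (fun v => size v < L)%N) _.
apply: (@le_trans _ _ (\sum_(l < n.+1) (l < L)%N%:R *
    (((2 * k)%:R * (7%:R / 8%:R)) ^+ n * k%:R ^+ l))).
  apply: ler_sum => l _.
  rewrite (eq_big_seq (fun v => (l < L)%N%:R * hits n v)); last first.
    by move=> v; rewrite mem_rwords => /andP[_ /eqP->].
  rewrite -mulr_sumr ler_wpM2l //.
  apply: (@le_trans _ _ (\sum_(v <- rwords l)
      ((2 * k)%:R * (7%:R / 8%:R)) ^+ n * 2^-1 ^+ l)).
    rewrite big_seq [leRHS]big_seq.
    apply: ler_sum => v; rewrite mem_rwords => /andP[rv /eqP<-].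
    apply: hits_le => //; try lra.
    by rewrite -subn1 natrB ?muln_gt0 // natrM; lra.
  rewrite -[X in \sum_(_ <- _) X]mulr1 -mulr_sumr -mulrA ler_wpM2l //.
    by apply: exprn_ge0; apply: mulr_ge0; [exact: ler0n | lra].
  apply: (@le_trans _ _ (2^-1 ^+ l * (2 * k)%:R ^+ l)).
    apply: ler_wpM2l; last exact: sum_rwords1_le.
    by apply: exprn_ge0; rewrite invr_ge0.
  by rewrite -exprMn natrM mulrA mulVf ?mul1r // pnatr_eq0.
rewrite exprMn; set A := _ ^+ n; set B := _ ^+ n.
have A0 : 0 <= A by rewrite exprn_ge0.
have B0 : 0 <= B by apply: exprn_ge0; lra.
have kL l : 0 <= k%:R ^+ l :> R by rewrite exprn_ge0.
apply: (@le_trans _ _ (\sum_(l < n.+1) (l < L)%N%:R * (A * B * k%:R ^+ L))).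
  apply: ler_sum => l _; have [lL|] := ltnP l L; last by rewrite !mul0r.
  rewrite !mul1r ler_wpM2l ?mulr_ge0 //.
  by rewrite ler_weXn2l ?(ltnW lL) // ler1n.
rewrite -mulr_suml; apply: (@le_trans _ _ (L%:R * (A * B * k%:R ^+ L))).
  rewrite ler_wpM2r ?mulr_ge0 // -natr_sum ler_nat -big_mkcond /=.
  rewrite -(big_mkord (fun l => l < L)%N (fun=> 1%N)) sum1_count -size_filter.
  rewrite -[leqRHS](size_iota 0); apply: uniq_leq_size.
    by rewrite filter_uniq ?iota_uniq.
  by move=> l; rewrite mem_filter !mem_iota => /andP[-> _].
by rewrite le_eqVlt; apply/orP; left; apply/eqP; lra.
Qed.

End Walk.

(** * Counting reduced words *)

Lemma leq_of_ltn_mul4 n l m : 0 < n -> n * m < 4 * l -> m <= 4 * (l %/ n) + 4.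
Proof.
move=> n0 lt; have := ltn_ceil l n0; rewrite mulSn mulnC => h.
by rewrite -ltnS -(ltn_pmul2l n0); apply: leq_trans lt _; lia.
Qed.

Section Counting.
Variable R : realType.
Variable k : nat.
Hypothesis hk : (2 <= k)%N.
Implicit Types (a b x y : letter k) (v w : seq (letter k)).
Implicit Type ok : letter k -> seq (letter k) -> bool.
Local Open Scope ring_scope.

Notation q := ((2 * k).-1).
Notation qR := (q%:R : R).

Let qRE : qR = 2 * k%:R - 1.
Proof. by rewrite -subn1 natrB ?natrM //; lia. Qed.

Let kR2 : 2 <= k%:R :> R. Proof. by rewrite ler_nat. Qed.

Let qR3 : 3 <= qR. Proof. by rewrite qRE; have := kR2; lra. Qed.

Fixpoint all_tails (ok : letter k -> seq (letter k) -> bool) v :=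
  if v is a :: w then ok a w && all_tails ok w else true.

Lemma all_tailsP ok v :
  (forall u a w, v = u ++ a :: w -> ok a w) -> all_tails ok v.
Proof.
elim: v => //= a v IHv H; rewrite (H [::]) //= IHv // => u b w e.
by apply: (H (a :: u)); rewrite e.
Qed.

Lemma sum_ext_le ok a v (I : bool) : reduced (a :: v) ->
    (I -> exists2 b, reduced (b :: a :: v) & ~~ ok b (a :: v)) ->
  \sum_(b | reduced (b :: a :: v)) (ok b (a :: v))%:R <=
  qR * ((qR - 1) / qR) ^+ I.
Proof.
move=> r hI; have cq : (\sum_(b | reduced (b :: a :: v)) 1 : R) = qR.
  rewrite sumr_const; congr (_%:R); have := card_letters_ext a v.
  by rewrite r mul1n.
case: I hI => [[//|b rb nb]|_]; last first.
  by rewrite expr0 mulr1 -[leRHS]cq; apply: ler_sum => b _; rewrite lern1 leq_b1.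
rewrite expr1 mulrCA divff ?mulr1; last by rewrite gt_eqF //; have := qR3; lra.
rewrite (bigD1 b) //= (negbTE nb) add0r -cq [X in _ <= X - 1](bigD1 b) //=.
rewrite [1 + _]addrC addrK; apply: ler_sum => c _.
by rewrite lern1 leq_b1.
Qed.

(** Forbidding one letter at each level of [I] costs a factor [(q - 1) / q] per
    level, [q = 2 * k - 1] being the number of continuations of a word. *)
Lemma constrained_words_le ok (I : pred nat) l :
    (forall a v, reduced (a :: v) -> I (size v).+1 ->
       exists2 b, reduced (b :: a :: v) & ~~ ok b (a :: v)) ->
  \sum_(v <- rwords k l) (all_tails ok v)%:R <=
  2 * qR ^+ l * ((qR - 1) / qR) ^+ count I (iota 0 l).
Proof.
move=> hI; set phi := (qR - 1) / qR.
have phi0 : 0 <= phi by rewrite divr_ge0 //; have := qR3; lra.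
have qphi : qR * phi = qR - 1.
  by rewrite /phi mulrC divfK // gt_eqF //; have := qR3; lra.
elim: l => [|l IHl]; first by rewrite big_seq1 /= !mulr1; lra.
case: l IHl => [_|l IHl].
  rewrite sum_rwordsS big_seq1; apply: (@le_trans _ _ (\sum_(a : letter k) 1)).
    by apply: ler_sum => a _; rewrite lern1 leq_b1.
  rewrite sumr_const card_letter expr1 /= addn0 -mulrA.
  have -> : (2 * k)%:R = qR + 1 :> R by rewrite natrM qRE; lra.
  case: (I 0); rewrite ?expr1 ?expr0; last by have := qR3; lra.
  by rewrite qphi; have := qR3; lra.
have -> : count I (iota 0 l.+2) = (count I (iota 0 l.+1) + I l.+1)%N.
  by rewrite -[in LHS](addn1 l.+1) iotaD count_cat add0n /= addn0.
rewrite sum_rwordsS.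
have -> : 2 * qR ^+ l.+2 * phi ^+ (count I (iota 0 l.+1) + I l.+1) =
    (2 * qR ^+ l.+1 * phi ^+ count I (iota 0 l.+1)) * (qR * phi ^+ I l.+1).
  by rewrite exprD exprSr; lra.
apply: (@le_trans _ _ (\sum_(v <- rwords k l.+1)
    (all_tails ok v)%:R * (qR * phi ^+ I l.+1))); last first.
  rewrite -mulr_suml ler_wpM2r // mulr_ge0 ?exprn_ge0 //.
rewrite big_seq [leRHS]big_seq; apply: ler_sum => -[|a v].
  by rewrite mem_rwords.
rewrite mem_rwords => /andP[r /eqP sv].
under eq_bigr => b _ do rewrite [all_tails ok (b :: _)]/= andbC -mulnb natrM.
rewrite -mulr_sumr ler_wpM2l //; apply: sum_ext_le => // Il.
by apply: hI => //; rewrite -[(size v).+1]/(size (a :: v)) sv.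
Qed.

(** Exponential moment of the number of occurrences of a turn [(x, y)]: the
    function [1 + t * corrector] of the first letter is almost an eigenvector,
    to first order in [t], of the operator which appends a letter and multiplies
    by [1 - t] when a turn [(x, y)] is created. *)
Section Moment.
Variables (x y : letter k) (t : R).
Hypotheses (xy : x != y) (t0 : 0 < t).
Let K : R := k%:R * qR.
Hypothesis tK : t * K <= 1.

Definition excess a : R := (a == x)%:R + (a == y)%:R - k%:R^-1.

(** The solution of the equation [correctorV]. On functions of mean zero the sum over
    the continuations of a word is an operator of square [1], whence the factor
    [qR ^+ 2 - 1]. *)
Definition corrector a : R :=
  (excess (letterV a) - qR * excess a) / (qR ^+ 2 - 1).

Definition is_turn a b : bool :=
  (a == letterV x) && (b == y) || (a == letterV y) && (b == x).

Let kV : k%:R^-1 * k%:R = 1 :> R.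
Proof. by rewrite mulVf // gt_eqF //; have := kR2; lra. Qed.

Let kV0 : 0 < k%:R^-1 :> R. Proof. by rewrite invr_gt0; have := kR2; lra. Qed.

Let kV1 : k%:R^-1 <= 2^-1 :> R.
Proof. by rewrite lef_pV2 ?posrE //; have := kR2; lra. Qed.

Let tK' : 0 < t * K /\ 6 * t <= t * K /\ t * k%:R * 3 <= t * K.
Proof.
have h1 : 6 <= K by rewrite /K; have := kR2; have := qR3; nra.
have h2 : k%:R * 3 <= K by rewrite /K ler_wpM2l // qR3.
have := ler_wpM2l (ltW t0) h1; have := ler_wpM2l (ltW t0) h2.
by split; [apply: mulr_gt0 => //; lra | split; lra].
Qed.

Lemma excess_bound a : `|excess a| <= 1.
Proof.
rewrite ler_norml /excess; have := kV0; have := kV1.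
have [->|nx] := eqVneq a x; first by rewrite (negbTE xy) /=; lra.
by case: (a == y) => /=; lra.
Qed.

Lemma sum_excess : \sum_a excess a = 0.
Proof.
rewrite sumrB big_split /=.
have s1 z : \sum_a (a == z)%:R = 1 :> R.
  rewrite (bigD1 z) //= eqxx big1 ?addr0 // => a /negbTE->.
  by [].
rewrite !s1 sumr_const card_letter -[_ *+ (2 * k)]mulr_natr natrM.
by have := kV; lra.
Qed.

Lemma corrector_bound a : `|corrector a| <= 2^-1.
Proof.
have q3 := qR3; have d0 : 0 < qR ^+ 2 - 1 by rewrite expr2; nra.
rewrite /corrector normrM normfV (gtr0_norm d0) ler_pdivrMr //.
apply: le_trans (ler_normB _ _) _; rewrite normrM (gtr0_norm (_ : 0 < qR)); last by lra.
have := excess_bound a; have := excess_bound (letterV a).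
rewrite expr2 => h1 h2; nra.
Qed.

Lemma sum_corrector : \sum_a corrector a = 0.
Proof.
rewrite -mulr_suml sumrB -mulr_sumr sum_excess mulr0 subr0.
have eV : \sum_a excess a = \sum_a excess (letterV a).
  exact: (reindex_inj (can_inj (@letterVK k))).
by rewrite -eV sum_excess mul0r.
Qed.

Lemma correctorV b : - corrector (letterV b) = qR * corrector b + excess b.
Proof.
have q3 := qR3; have d0 : qR ^+ 2 - 1 != 0 by rewrite gt_eqF // expr2; nra.
rewrite /corrector letterVK; have := congr1 (fun z => excess b * z) (mulVf d0).
by set i := _^-1; rewrite expr2; lra.
Qed.

Definition weight a := 1 + t * corrector a.

Lemma weight_bound a : 1 - t / 2 <= weight a <= 1 + t / 2.
Proof.
have := corrector_bound a; rewrite ler_norml /weight => /andP[h1 h2].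
by have t0' := t0; apply/andP; split; nra.
Qed.

Lemma sum_turn_weight b : \sum_(a | a != letterV b)
    (1 - t) ^+ is_turn a b * weight a <=
  qR * (1 - t * (1 - t * K) / K) * weight b.
Proof.
have w0 a : 0 <= weight a.
  by have /andP[] := weight_bound a; have := tK'; have := t0; have := tK; lra.
have sw : \sum_(a | a != letterV b) weight a = qR - t * corrector (letterV b).
  rewrite big_split /= -mulr_sumr sumr_const cardC1 card_letter.
  have -> : \sum_(a | a != letterV b) corrector a = - corrector (letterV b).
    have := sum_corrector; rewrite (bigD1 (letterV b)) //=; lra.
  by rewrite mulrN.
have st : ((b == x)%:R + (b == y)%:R) * (1 - t / 2) <=
    \sum_(a | a != letterV b) (is_turn a b)%:R * weight a.
  have H c d : b = c -> d != c -> is_turn (letterV d) b -> 1 - t / 2 <=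
      \sum_(a | a != letterV b) (is_turn a b)%:R * weight a.
    move=> -> dc it; rewrite (bigD1 (letterV d)) /=; last first.
      by rewrite (inj_eq (can_inj (@letterVK k))).
    rewrite it mul1r; have /andP[h _] := weight_bound (letterV d).
    by apply: ler_wpDr => //; apply: sumr_ge0 => a _; rewrite mulr_ge0.
  have [bx|nx] := eqVneq b x.
    rewrite bx (negbTE xy) addr0 mul1r -bx; apply: (H x y) => //.
      by rewrite eq_sym.
    by rewrite /is_turn bx !eqxx orbT.
  have [by_|ny] := eqVneq b y.
    by rewrite add0r mul1r; apply: (H y x) => //; rewrite /is_turn by_ !eqxx.
  by rewrite addr0 mul0r; apply: sumr_ge0 => a _; rewrite mulr_ge0.
have -> : \sum_(a | a != letterV b) (1 - t) ^+ is_turn a b * weight a =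
    \sum_(a | a != letterV b) weight a -
    t * \sum_(a | a != letterV b) (is_turn a b)%:R * weight a.
  rewrite mulr_sumr -sumrB; apply: eq_bigr => a _.
  by case: is_turn; rewrite ?expr1 ?expr0 /=; lra.
rewrite sw; have eV := correctorV b.
have ex : (b == x)%:R + (b == y)%:R = excess b + k%:R^-1 by rewrite /excess; lra.
have ex1 : (b == x)%:R + (b == y)%:R <= 1 :> R.
  have [->|_] := eqVneq b x; first by rewrite (negbTE xy) /=; lra.
  by case: (b == y) => /=; lra.
rewrite ex in st ex1.
have /andP[_ wb] := weight_bound b.
pose X := t * (1 - t * K) / K; rewrite -/X.
have qX : qR * X = t * (1 - t * K) * k%:R^-1.
  have hq : qR * qR^-1 = 1 by rewrite divff // gt_eqF //; have := qR3; lra.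
  have -> : qR * X = t * (1 - t * K) * k%:R^-1 * (qR * qR^-1).
    by rewrite /X [K^-1]invfM mulrCA -(mulrA _ k%:R^-1) [qR * (_ / _)]mulrCA.
  by rewrite hq mulr1.
have hX : qR * X * weight b <= t * k%:R^-1 - t ^+ 2 / 2.
  have h0 : 0 <= qR * X.
    rewrite qX mulr_ge0 ?(ltW kV0) // mulr_ge0 ?(ltW t0) //.
    by have := tK; lra.
  apply: (le_trans (ler_wpM2l h0 wb)); rewrite qX.
  suff : (1 - t * K) * (1 + t / 2) <= 1 - t * k%:R / 2.
    move=> h; have := ler_wpM2l (ltW (mulr_gt0 t0 kV0)) h.
    have -> : t / k%:R * (1 - t * k%:R / 2) =
       t / k%:R - t ^+ 2 / 2 * (k%:R^-1 * k%:R) by lra.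
    by rewrite kV mulr1; lra.
  have [h1 [h2 h3]] := tK'; have := t0.
  by have : 0 <= t * (t * K) by [rewrite mulr_ge0 // ltW]; lra.
have hs := ler_wpM2l (ltW t0) st.
have t2 : t ^+ 2 * (excess b + k%:R^-1) <= t ^+ 2.
  by rewrite ler_piMr // sqr_ge0.
have eVt : t * - corrector (letterV b) = t * (qR * corrector b + excess b).
  by rewrite eV.
clearbody X; rewrite /weight in hX *; lra.
Qed.

Lemma turn2_cons a b v : turn2 x y (a :: b :: v) =
  (is_turn a b + turn2 x y (b :: v))%N.
Proof.
have e c d : turns c d (a :: b :: v) =
    ((a == letterV c) && (b == d) + turns c d (b :: v))%N by [].
rewrite /turn2 !e addnACA /is_turn; congr (_ + _)%N.
have [eb|_] := eqVneq b y; last by rewrite !andbF.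
have yx : (y == x) = false by rewrite eq_sym (negbTE xy).
by rewrite eb yx !andbF orbF addn0.
Qed.

Lemma turn_moment l :
  \sum_(v <- rwords k l) (1 - t) ^+ turn2 x y v <=
  8 * k%:R * (qR * (1 - t * (1 - t * K) / K)) ^+ l.
Proof.
have [tK1 [tK2 _]] := tK'; have t1 := tK; have k2 := kR2; have q3 := qR3.
have K6 : 6 <= K by rewrite /K; nra.
set B := qR * _.
have B1 : 1 <= B.
  have h : t * (1 - t * K) / K <= 2^-1.
    rewrite ler_pdivrMr; last by lra.
    by have t0' := t0; nra.
  by rewrite /B; nra.
have B0 : 0 <= B by lra.
case: l => [|l]; first by rewrite big_seq1 expr0 /turn2 /= addn0 expr0; lra.
have w_ge a : 2^-1 <= weight a.
  by have /andP[] := weight_bound a; have := t0; lra.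
have H : \sum_(v <- rwords k l.+1)
    (1 - t) ^+ turn2 x y v * weight (head x v) <= (2 * k)%:R * B ^+ l *+ 2.
  elim: l => [|l IHl].
    rewrite sum_rwordsS big_seq1 expr0 mulr1.
    apply: (@le_trans _ _ (\sum_(a : letter k) 2)).
      apply: ler_sum => a _; rewrite /turn2 /= !andbF !addn0 expr0 mul1r.
      by have /andP[_] := weight_bound a; have := t0; lra.
    by rewrite sumr_const card_letter -[2 *+ _]mulr_natr -[leRHS]mulr_natr mulrC.
  rewrite sum_rwordsS; apply: (@le_trans _ _ (\sum_(v <- rwords k l.+1)
      B * ((1 - t) ^+ turn2 x y v * weight (head x v)))); last first.
    rewrite -mulr_sumr exprS mulrCA -mulrnAr ler_wpM2l //.
  rewrite big_seq [leRHS]big_seq; apply: ler_sum => -[|b v].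
    by rewrite mem_rwords.
  rewrite mem_rwords => /andP[r _].
  rewrite mulrCA [head x _]/=.
  apply: (@le_trans _ _ ((1 - t) ^+ turn2 x y (b :: v) *
      \sum_(a | a != letterV b) (1 - t) ^+ is_turn a b * weight a)).
    rewrite mulr_sumr le_eqVlt; apply/orP; left; apply/eqP.
    apply: eq_big => a.
      by move: r; rewrite /reduced /= => ->; rewrite andbT eq_sym letterV_eq eq_sym.
    by move=> _; rewrite turn2_cons exprD mulrA [X in X * _]mulrC.
  apply: ler_wpM2l; first by apply: exprn_ge0; lra.
  exact: sum_turn_weight.
apply: (@le_trans _ _ (2 * \sum_(v <- rwords k l.+1)
    (1 - t) ^+ turn2 x y v * weight (head x v))).
  rewrite mulr_sumr; apply: ler_sum => v _; rewrite mulrCA ler_peMr //.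
    by apply: exprn_ge0; lra.
  by have := w_ge (head x v); lra.
have Bl : B ^+ l <= B ^+ l.+1 by rewrite ler_weXn2l.
have kB := ler_wpM2l (_ : 0 <= k%:R :> R) Bl.
rewrite -mulr_natr natrM in H; have := kB ltac:(lra); lra.
Qed.

End Moment.

(** With [t] small enough, fewer than [4 * l / (4 * K + 1)] occurrences of a turn
    among [l] letters is a large deviation, as [4 / (4 * K + 1) < 1 / K]. *)
Lemma deviation_rate (K t : R) n : 1 <= K -> t = K ^- 2 / 100%:R ->
    n%:R = 4 * K + 1 ->
  0 < t /\ t * K <= 1 /\ (1 - t * (1 - t * K) / K) ^+ n < (1 - t) ^+ 4.
Proof.
move=> K1 et en; have K0 : 0 < K by lra.
pose s := K^-1; have sK : s * K = 1 by rewrite mulVf // gt_eqF.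
have s0 : 0 < s by rewrite invr_gt0.
have s1 : s <= 1 by rewrite invf_le1.
have {}et : t = s ^+ 2 / 100%:R by rewrite et exprVn.
have t0 : 0 < t by rewrite et divr_gt0 // exprn_gt0.
have tK : t * K = s / 100%:R.
  by have := congr1 (fun z => s * z) sK; rewrite et expr2; lra.
have ts : t <= s / 100%:R by rewrite et expr2; nra.
pose X := t * (1 - t * K) * s; rewrite -[_ / K]/X.
have X0 : 0 <= X by rewrite /X tK mulr_ge0 ?(ltW s0) // mulr_ge0 ?(ltW t0) //; lra.
have X1 : X <= t by rewrite /X tK; nra.
split=> //; split; first by rewrite tK; lra.
have nX : n%:R * X = t * (1 - t * K) * (4 + s).
  rewrite en /X; have -> : (4 * K + 1) * (t * (1 - t * K) * s) =
    t * (1 - t * K) * (4 * (s * K) + s) by lra.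
  by rewrite sK mulr1.
have h1 : (1 - X) ^+ n * (1 + n%:R * X) <= 1.
  apply: (@le_trans _ _ ((1 - X) ^+ n * (1 + X) ^+ n)).
    by rewrite ler_wpM2l ?exprn_ge0 ?bernoulli //; lra.
  rewrite -exprMn exprn_ile1 //; nra.
have h2 : 1 - 4 * t <= (1 - t) ^+ 4.
  by have := @bernoulli R (- t) 4; move=> /(_ ltac:(lra)); lra.
apply: lt_le_trans h2.
have h3 : 1 < (1 - 4 * t) * (1 + n%:R * X).
  rewrite nX tK.
  have h : 4 + 4 * t * ((1 - s / 100%:R) * (4 + s)) < (1 - s / 100%:R) * (4 + s).
    nra.
  have : t * (4 + 4 * t * ((1 - s / 100%:R) * (4 + s))) <
    t * ((1 - s / 100%:R) * (4 + s)) by rewrite ltr_pM2l.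
  lra.
have n0 : 0 < 1 + n%:R * X by have : 0 <= n%:R * X by [rewrite mulr_ge0]; lra.
by rewrite -(ltr_pM2r n0); apply: le_lt_trans h3.
Qed.

Lemma few_turns_words : let K := (k * q)%N in exists C eta : R,
  [/\ 0 < C, 0 < eta, eta < 1 & forall l (x y : letter k), x != y ->
    \sum_(v <- rwords k l) ((4 * K + 1) * turn2 x y v < 4 * l)%N%:R <=
    C * qR ^+ l * eta ^+ (l %/ (4 * K + 1))].
Proof.
move=> K; pose KR : R := k%:R * qR; pose n := (4 * K + 1)%N.
have KRE : KR = K%:R by rewrite natrM.
have K1 : 1 <= KR by rewrite KRE ler1n /K; nia.
have [t et] : exists t : R, t = KR ^- 2 / 100%:R by eexists.
have en : n%:R = 4 * KR + 1 by rewrite KRE natrD natrM.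
have [t0 [tK]] := deviation_rate K1 et en.
set X := t * (1 - t * KR) / KR => hX.
have K2 : 2 <= KR by rewrite KRE ler_nat /K; nia.
have t1 : t < 1 by have := ler_wpM2l (ltW t0) K2; lra.
have th0 : 0 < 1 - t by lra.
have X0 : 0 <= X.
  by rewrite divr_ge0 ?mulr_ge0 ?(ltW t0) //; lra.
have X1 : 0 < 1 - X.
  suff : X <= t by lra.
  rewrite ler_pdivrMr; last by lra.
  by apply: ler_wpM2l; [exact: ltW | have := mulr_gt0 t0 (_ : 0 < KR); lra].
exists (8 * k%:R / (1 - t) ^+ 4), ((1 - X) ^+ n / (1 - t) ^+ 4).
have k2 := kR2; have q3 := qR3; split.
- by rewrite divr_gt0 ?exprn_gt0 //; lra.
- by rewrite divr_gt0 ?exprn_gt0.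
- by rewrite ltr_pdivrMr ?exprn_gt0 // mul1r.
move=> l x y xy; pose j := (l %/ n)%N.
have hm := turn_moment xy t0 tK l; rewrite -/KR -/X in hm.
apply: (@le_trans _ _ (\sum_(v <- rwords k l)
    (1 - t) ^+ turn2 x y v / (1 - t) ^+ (4 * j + 4))).
  apply: ler_sum => v _; have [lt|_] := ltnP; last first.
    by apply: divr_ge0; apply/exprn_ge0/ltW.
  rewrite ler_pdivlMr ?exprn_gt0 // mul1r.
  apply: ler_wiXn2l; [lra | lra |].
  by apply: leq_of_ltn_mul4 lt; rewrite addn1.
rewrite -mulr_suml; apply: (le_trans (ler_wpM2r _ hm)).
  by rewrite invr_ge0; apply/exprn_ge0/ltW.
rewrite exprMn exprD exprM invfM.
have -> : 8 * k%:R / (1 - t) ^+ 4 * qR ^+ l * ((1 - X) ^+ n / (1 - t) ^+ 4) ^+ j =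
   8 * k%:R * qR ^+ l * ((1 - X) ^+ (n * j)) * (((1 - t) ^+ 4 ^+ j)^-1 / (1 - t) ^+ 4).
  rewrite expr_div_n exprM; move: (_ ^+ j) (_ ^+ j)^-1 (_ ^- 4) => A B D.
  by move: (qR ^+ l) => E; lra.
rewrite [8 * _ * (_ * _)]mulrA ler_wpM2r //.
  by rewrite mulr_ge0 ?invr_ge0 ?exprn_ge0 // ltW.
apply: ler_wpM2l; first by rewrite mulr_ge0 ?exprn_ge0 //; lra.
by rewrite ler_wiXn2l ?(ltW X1) //; [lra | rewrite mulnC leq_divM].
Qed.

End Counting.

(** * Probability of the exceptional events *)

Section WalkProb.
Variable R : realType.
Variables k p n : nat.
Hypothesis k0 : (0 < k)%N.
Implicit Types (E F : set (walks k p n)) (s : walks k p n).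
Local Open Scope ring_scope.

Notation T := ((2 * k)%:R ^+ n : R).

Let T0 : 0 < T. Proof. by rewrite exprn_gt0 // ltr0n muln_gt0. Qed.

Lemma walk_probE E :
  walk_prob R E = (\sum_s `[< E s >]%:R) / T ^+ p.
Proof.
rewrite /walk_prob big_mkcond mulr_suml; apply: eq_bigr => s _.
rewrite !prodr_const !card_ord card_letter exprVn exprVn.
by case: asboolP => _; rewrite ?mul1r ?mul0r.
Qed.

Lemma walk_prob_le E F : (forall s, E s -> F s) -> walk_prob R E <= walk_prob R F.
Proof.
move=> EF; rewrite !walk_probE ler_wpM2r ?invr_ge0 ?exprn_ge0 ?(ltW T0) //.
apply: ler_sum => s _; rewrite ler_nat; case: asboolP => // /EF Fs.
by case: asboolP.
Qed.

Lemma walk_prob_le1 E : walk_prob R E <= 1.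
Proof.
by rewrite -(walk_prob_setT R p n k0); apply: walk_prob_le.
Qed.

Lemma walk_probU E F :
  walk_prob R [set s | E s \/ F s] <= walk_prob R E + walk_prob R F.
Proof.
rewrite !walk_probE -mulrDl ler_wpM2r ?invr_ge0 ?exprn_ge0 ?(ltW T0) //.
rewrite -big_split /=; apply: ler_sum => s _; rewrite -natrD ler_nat.
case: asboolP => //= -[Es|Fs]; first by rewrite (asboolT Es).
by rewrite (asboolT Fs) addn1.
Qed.

Lemma walk_prob_exists (I : finType) (E : I -> set (walks k p n)) eps :
    (forall i, walk_prob R (E i) <= eps) ->
  walk_prob R [set s | exists i, E i s] <= #|I|%:R * eps.
Proof.
move=> hE; apply: (@le_trans _ _ (\sum_i walk_prob R (E i))); last first.
  rewrite mulr_natl -sumr_const; exact: ler_sum.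
under [leRHS]eq_bigr => i _ do rewrite walk_probE.
rewrite walk_probE -mulr_suml ler_wpM2r ?invr_ge0 ?exprn_ge0 ?(ltW T0) //.
rewrite exchange_big /=; apply: ler_sum => s _.
case: asboolP => [[i Ei]|_]; last by apply: sumr_ge0.
by rewrite (bigD1 i) //= (asboolT Ei) lerDl sumr_ge0.
Qed.

Definition resample s i (t : n.-tuple (letter k)) : walks k p n :=
  [ffun j => if j == i then t else s j].

Lemma resampleK s i t : resample (resample s i t) i (s i) = s.
Proof. by apply/ffunP => j; rewrite !ffunE; case: eqP => // ->. Qed.

Lemma resample_at s i t : resample s i t i = t.
Proof. by rewrite ffunE eqxx. Qed.

(** Conditioning on all the walks but one. *)
Lemma walk_prob_resample E i (Q : walks k p n -> pred (seq (letter k))) eps :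
    (forall s t, E (resample s i t) -> Q s (word_mul t [::])) ->
    (forall s, walk_freq R n (Q s) <= eps) ->
  walk_prob R E <= eps.
Proof.
move=> EQ hQ; rewrite walk_probE ler_pdivrMr; last exact/exprn_gt0/T0.
rewrite -(ler_pM2r T0).
have -> : (\sum_s `[< E s >]%:R) * T = \sum_(x : walks k p n * n.-tuple (letter k))
    `[< E (resample x.1 i x.2) >]%:R :> R.
  rewrite (reindex (fun x : walks k p n * n.-tuple (letter k) =>
    (resample x.1 i x.2, x.1 i))) /=; last first.
    exists (fun x => (resample x.1 i x.2, x.1 i)) => -[s t] _ /=;
      by rewrite resampleK resample_at.
  under [RHS]eq_bigr => x _ do rewrite resampleK.
  rewrite -(pair_bigA _ (fun s _ => `[< E s >]%:R)) /=.
  rewrite mulr_suml; apply: eq_bigr => s _.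
  by rewrite sumr_const -[RHS]mulr_natr card_tuple card_letter natrX.
rewrite -(pair_bigA _ (fun s t => `[< E (resample s i t) >]%:R)) /=.
apply: (@le_trans _ _ (\sum_(s : walks k p n) eps * T)); last first.
  rewrite sumr_const -[leLHS]mulr_natr card_ffun card_ord card_tuple.
  by rewrite card_letter !natrX; lra.
apply: ler_sum => s _; have hs := hQ s; rewrite /walk_freq ler_pdivrMr // in hs.
apply: le_trans hs; apply: ler_sum => t _; rewrite ler_nat.
by case: asboolP => // /EQ ->.
Qed.

End WalkProb.

Section Windows.
Variable R : realType.
Variable k : nat.
Hypothesis hk : (2 <= k)%N.
Implicit Types (a b : letter k) (u v w x y z : seq (letter k)).
Implicit Type ok : letter k -> seq (letter k) -> bool.
Local Open Scope ring_scope.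

Notation q := ((2 * k).-1).
Notation phi := ((q%:R - 1) / q%:R : R).

Lemma count_interval m h l : (m + h <= l)%N ->
  count (fun j => m <= j < m + h)%N (iota 0 l) = h.
Proof.
move=> le_l; have -> : l = (m + (h + (l - (m + h))))%N by lia.
rewrite !iotaD !count_cat add0n.
rewrite (@eq_in_count _ _ pred0 (iota 0 m)) ?count_pred0; last first.
  by move=> j; rewrite mem_iota /=; lia.
rewrite (@eq_in_count _ _ predT (iota m h)) ?count_predT ?size_iota; last first.
  by move=> j; rewrite mem_iota => ->.
rewrite (@eq_in_count _ _ pred0) ?count_pred0 ?addn0 // => j.
by rewrite mem_iota /=; lia.
Qed.

(** Words are enumerated by adding letters on the left; so positions are counted
    from the right, and the constraint on a letter may depend on all the letters
    to its right. *)
Lemma walk_freq_window n ok (Q : pred (seq (letter k))) m h :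
    (forall b v, reduced (b :: v) ->
       exists2 a, reduced (a :: b :: v) & ~~ ok a (b :: v)) ->
    (forall v, Q v -> (m + h <= size v)%N /\
       forall u a w, v = u ++ a :: w -> (m <= size w < m + h)%N -> ok a w) ->
  walk_freq R n Q <= n.+1%:R * (2 * phi ^+ h).
Proof.
move=> hok hQ; have q0 : 0 < q%:R :> R by rewrite ltr0n; lia.
have q1 : 1 <= q%:R :> R by rewrite ler1n; lia.
have phi0 : 0 <= phi by rewrite divr_ge0 ?subr_ge0 // ltW.
apply: le_trans (walk_freq_le R n Q _) _; first by lia.
rewrite -[n.+1 in leRHS]card_ord mulr_natl -sumr_const; apply: ler_sum => l _.
rewrite mulrC ler_pdivrMr ?exprn_gt0 //.
have [le_l|lt_l] := leqP (m + h) l; last first.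
  rewrite big_seq big1 ?mulr_ge0 ?exprn_ge0 ?(ltW q0) // => v.
  rewrite mem_rwords => /andP[_ /eqP sv]; case Qv: (Q v) => //.
  by have [] := hQ v Qv; rewrite sv leqNgt lt_l.
pose I j := (m <= j < m + h)%N.
pose ok' a w := I (size w) ==> ok a w.
rewrite -(count_interval le_l).
rewrite mulrAC; apply: le_trans (@constrained_words_le R k hk ok' I l _).
  apply: ler_sum => v _; rewrite ler_nat; case Qv: (Q v) => //.
  rewrite all_tailsP // => u a w e; apply/implyP => Iw.
  by have [_ H] := hQ v Qv; apply: (H u).
move=> a v r Iv; have [b rb nb] := hok a v r; exists b => //.
by rewrite /ok' /= Iv.
Qed.

(** As there are at least four letters, some continuation of a reduced word differs
    from the prescribed letter. *)
Lemma walk_freq_determined n (Phi : seq (letter k) -> letter k)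
    (Q : pred (seq (letter k))) m h :
    (forall v, Q v -> (m + h <= size v)%N /\
       forall u a w, v = u ++ a :: w -> (m <= size w < m + h)%N -> a = Phi w) ->
  walk_freq R n Q <= n.+1%:R * (2 * phi ^+ h).
Proof.
move=> hQ; apply: (@walk_freq_window _ (fun a w => a == Phi w) _ m) => [b v r|v Qv].
  have [a [a1 a2]] := letter_avoid2 hk (letterV b) (Phi (b :: v)).
  exists a => //; move: r; rewrite /reduced /= => ->.
  by rewrite andbT eq_sym letterV_eq.
have [h1 h2] := hQ v Qv; split=> // u a w e hw.
by apply/eqP; apply: h2 e hw.
Qed.

(** Counting from the right makes the position of a letter insensitive to the
    letters added later on the left. *)
Definition level (d : letter k) v j := nth d (rev v) j.

Lemma level_cat_cons d u a w : level d (u ++ a :: w) (size w) = a.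
Proof.
by rewrite /level rev_cat rev_cons cat_rcons nth_cat size_rev ltnn subnn.
Qed.

Lemma level_catr d u w j : (j < size w)%N -> level d (u ++ w) j = level d w j.
Proof. by move=> jw; rewrite /level rev_cat nth_cat size_rev jw. Qed.

Lemma level_window d u x w j : (j < size x)%N ->
  level d (u ++ x ++ w) (size w + j) = nth d (rev x) j.
Proof.
move=> jx; rewrite /level catA !rev_cat nth_cat size_rev ltnNge leq_addr /=.
by rewrite addKn nth_cat size_rev jx.
Qed.

(** Two distinct walks sharing a word: given the first one, the word is fixed. *)
Lemma walk_freq_fixed_word n (d : letter k) x c (Q : pred (seq (letter k))) h :
    (h <= size x)%N ->
    (forall v, Q v -> exists u w, v = u ++ x ++ w /\ size w = c) ->
  walk_freq R n Q <= n.+1%:R * (2 * phi ^+ h).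
Proof.
move=> hx hQ.
apply: (@walk_freq_determined _ (fun w => nth d (rev x) (size w - c)) _ c).
move=> v /hQ[u [w [-> sw]]]; split; first by rewrite !size_cat; lia.
move=> u' a w' e /andP[h1 h2].
rewrite -[LHS](level_cat_cons d u' a w') -e -(subnKC h1) -{1}sw level_window.
  by rewrite subnKC.
by lia.
Qed.

(** A word repeated in the same walk at another position: the occurrences may
    overlap, but the left one is determined by the right one. *)
Lemma walk_freq_translate n (d : letter k) (pi : letter k -> letter k) c c' r h
    (Q : pred (seq (letter k))) : (c < c')%N -> (h <= r)%N ->
    (forall v, Q v -> (c' + r <= size v)%N /\ forall j, (j < r)%N ->
       level d v (c' + j) = pi (level d v (c + j))) ->
  walk_freq R n Q <= n.+1%:R * (2 * phi ^+ h).
Proof.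
move=> cc' hr hQ; apply: (@walk_freq_determined _
  (fun w => pi (level d w (c + (size w - c')))) _ c').
move=> v /hQ[sv H]; split; first by lia.
move=> u a w e /andP[h1 h2].
rewrite -[LHS](level_cat_cons d u a w) -e -{1}(subnKC h1) H; last by lia.
by rewrite e -cat_rcons level_catr //; lia.
Qed.

(** A word whose inverse occurs in the same walk: the two windows may coincide, in
    which case only the left half is determined by the right half. *)
Lemma walk_freq_reflect n (d : letter k) (pi : letter k -> letter k) c c' h
    (Q : pred (seq (letter k))) : (c <= c')%N ->
    (forall v, Q v -> (c' + (2 * h + 1) <= size v)%N /\
       forall j, (j < 2 * h + 1)%N ->
       level d v (c' + j) = pi (level d v (c + (2 * h - j)))) ->
  walk_freq R n Q <= n.+1%:R * (2 * phi ^+ h).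
Proof.
move=> cc' hQ; apply: (@walk_freq_determined _
  (fun w => pi (level d w (c + (2 * h - (size w - c'))))) _ (c' + h + 1)%N).
move=> v /hQ[sv H]; split; first by lia.
move=> u a w e /andP[h1 h2].
have c'w : (c' <= size w)%N by lia.
rewrite -[LHS](level_cat_cons d u a w) -e -{1}(subnKC c'w) H; last by lia.
by rewrite e -cat_rcons level_catr //; lia.
Qed.

(** A letter moved by [s] is never alone: its inverse is moved too, and one of the
    two can be added to a given word. *)
Lemma walk_freq_fixed_letters n (d : letter k) (s : {perm letter k}) c h
    (Q : pred (seq (letter k))) : signed_perm s -> s != 1%g ->
    (forall v, Q v -> (c + h <= size v)%N /\ forall j, (j < h)%N ->
       s (level d v (c + j)) = level d v (c + j)) ->
  walk_freq R n Q <= n.+1%:R * (2 * phi ^+ h).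
Proof.
move=> sV s1 hQ; have [a0 na0] : exists a, s a != a.
  apply/existsP; apply: contraR s1; rewrite negb_exists => /forallP H.
  by apply/eqP/permP => a; rewrite perm1; apply/eqP; have := H a; rewrite negbK.
apply: (@walk_freq_window _ (fun a _ => s a == a) _ c) => [b v r|v /hQ[sv H]].
  have [e|ne] := eqVneq b (letterV a0); last first.
    exists a0 => //; move: r; rewrite /reduced /= => ->.
    by rewrite ne.
  exists (letterV a0); last by rewrite sV (inj_eq (can_inj (@letterVK k))).
  by move: r; rewrite /reduced /= => ->; rewrite letterVK e letterV_neq.
split=> // u a w e /andP[h1 h2].
rewrite -(level_cat_cons d u a w) -e -(subnKC h1) H //; lia.
Qed.

End Windows.

(** * Genericity of small cancellation *)

Section Genericity.
Variable R : realType.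
Variables k p : nat.
Hypothesis hk : (2 <= k)%N.
Local Open Scope ring_scope.

Notation q := ((2 * k).-1).
Notation phi := ((q%:R - 1) / q%:R : R).
Notation K := (k * (2 * k - 1))%N.

Let k0 : (0 < k)%N. Proof. by apply: leq_trans hk. Qed.

Definition walk_ends n (s : walks k p n) (i : 'I_p) : free_group k := ev (s i).

Lemma fg_word_walk_ends n (s : walks k p n) i :
  fg_word (walk_ends s i) = word_mul (s i) [::].
Proof. exact: fg_word_walk. Qed.

Lemma walk_ends_resample n (s : walks k p n) i t :
  walk_ends (resample s i t) i = ev t.
Proof. by rewrite /walk_ends resample_at. Qed.

(** A violation of small cancellation, with its position: the repeated word ends
    at distance [c] from the end of the generator [i], and at distance [c'] from
    the end of the generator [j]. *)
Definition cancellation_fails n h (s : {perm letter k}) (i j : 'I_p) (e : bool)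
    (c c' : nat) (w : walks k p n) : Prop :=
  signed_perm s /\ exists y x z y' z',
  [/\ gen_word (walk_ends w) (i, true) = y ++ x ++ z, size x = (2 * h + 1)%N,
      gen_word (walk_ends w) (j, e) = y' ++ map s x ++ z',
      size z = c /\ (if e then size z' else size y') = c' &
      ~ [/\ s = 1%g, (i, true) = (j, e) & size y = size y']].

Lemma gen_word_walk n (w : walks k p n) i e :
  gen_word (walk_ends w) (i, e) =
  if e then word_mul (w i) [::] else word_inv (word_mul (w i) [::]).
Proof.
by case: e; rewrite /gen_word /letter_eval /= ?fg_wordV fg_word_walk_ends.
Qed.

Lemma cancellation_fails_prob n h s i j e c c' :
  walk_prob R (@cancellation_fails n h s i j e c c') <=
  n.+1%:R * (2 * phi ^+ h).
Proof.
pose d : letter k := (Ordinal k0, true).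
have [eij|nij] := eqVneq i j; last first.
  (* Distinct walks: fix the first one, hence the word [x1]. *)
  pose r := (2 * h + 1)%N.
  pose x0 (w : walks k p n) := let v := word_mul (w i) [::] in
    take r (drop (size v - r - c) v).
  pose x1 w := if e then map s (x0 w) else word_inv (map s (x0 w)).
  apply: (@walk_prob_resample R k p n k0 _ j (fun w v =>
    `[< size (x1 w) = r /\ exists u z, v = u ++ x1 w ++ z /\ size z = c' >])).
    move=> w t [_ [y [x [z [y' [z' [e1 sx e2 [sz sc'] _]]]]]]].
    rewrite gen_word_walk ffunE (negbTE nij) in e1.
    rewrite gen_word_walk resample_at in e2.
    have ex : x0 w = x.
      rewrite /x0 e1 !size_cat sx sz -/r (_ : _ - _ - _ = size y)%N; last by lia.
      by rewrite drop_size_cat // take_size_cat.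
    apply/asboolP; rewrite /x1 ex; case: (e) e2 sc' => e2 sc'.
      by rewrite size_map; split=> //; exists y', z'.
    rewrite size_word_inv size_map; split=> //.
    exists (word_inv z'), (word_inv y'); rewrite size_word_inv; split=> //.
    by rewrite -[LHS]word_invK e2 !word_inv_cat catA.
  move=> w; have [sx|nsx] := eqVneq (size (x1 w)) r.
    apply: (@walk_freq_fixed_word R k hk n d (x1 w) c'); first by rewrite sx /r; lia.
    by move=> v /asboolP[_].
  apply: (@walk_freq_fixed_word R k hk n d (nseq h d) c'); first by rewrite size_nseq.
  by move=> v /asboolP[/eqP]; rewrite (negbTE nsx).
rewrite -{j}eij; have hr : (h <= 2 * h + 1)%N by lia.
have [sV|nsV] := pselect (signed_perm s); last first.
  apply: (@walk_prob_resample R k p n k0 _ i (fun _ _ => false)).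
    by move=> w t [].
  move=> w; apply: (@walk_freq_fixed_word R k hk n d (nseq h d) c') => //.
  by rewrite size_nseq.
have H (Q : pred (seq (letter k))) : walk_freq R n Q <= n.+1%:R * (2 * phi ^+ h) ->
    (forall v y x z y' z', v = y ++ x ++ z -> size x = (2 * h + 1)%N ->
      (if e then v else word_inv v) = y' ++ map s x ++ z' ->
      size z = c -> (if e then size z' else size y') = c' ->
      ~ [/\ s = 1%g, (i, true) = (i, e) & size y = size y'] -> Q v) ->
  walk_prob R (@cancellation_fails n h s i i e c c') <= n.+1%:R * (2 * phi ^+ h).
  move=> hQ HQ; apply: (@walk_prob_resample R k p n k0 _ i (fun _ => Q)) => //.
  move=> w t [_ [y [x [z [y' [z' [e1 sx e2 [sz sc'] ns]]]]]]].
  rewrite gen_word_walk resample_at in e1; rewrite gen_word_walk resample_at in e2.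
  exact: HQ e1 sx e2 sz sc' ns.
(* The same walk, and its inverse: the positions are exchanged by a reflection. *)
case: e H => H; last first.
  have H' v y x z y' z' : v = y ++ x ++ z -> size x = (2 * h + 1)%N ->
      word_inv v = y' ++ map s x ++ z' -> size z = c -> size y' = c' ->
    [/\ (c + (2 * h + 1) <= size v)%N, (c' + (2 * h + 1) <= size v)%N &
      forall j, (j < 2 * h + 1)%N ->
        level d v (c' + j) = letterV (s (level d v (c + (2 * h - j))))].
    move=> e1 sx e2 sz sy'.
    have ev' : v = word_inv z' ++ word_inv (map s x) ++ word_inv y'.
      by rewrite -[LHS]word_invK e2 !word_inv_cat catA.
    split; first by rewrite e1 !size_cat; lia.
      by rewrite ev' !size_cat !size_word_inv size_map; lia.
    move=> j jr; rewrite {1}ev' e1 -sz -sy' -(size_word_inv y').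
    rewrite level_window ?size_word_inv ?size_map ?sx //.
    rewrite level_window; last by rewrite sx; lia.
    rewrite /word_inv revK -map_comp (nth_map d) ?sx //= nth_rev ?sx; last by lia.
    by congr (letterV (s (nth _ _ _))); lia.
  have [le_c|lt_c] := leqP c c'.
    apply: (H (fun v => `[< (c' + (2 * h + 1) <= size v)%N /\
        forall j, (j < 2 * h + 1)%N ->
        level d v (c' + j) = letterV (s (level d v (c + (2 * h - j)))) >])).
      apply: (@walk_freq_reflect R k hk n d (fun a => letterV (s a)) c c') => //.
      by move=> v /asboolP.
    move=> v y x z y' z' e1 sx e2 sz sy' _; apply/asboolP.
    by have [_ h1 h2] := H' v y x z y' z' e1 sx e2 sz sy'.
  apply: (H (fun v => `[< (c + (2 * h + 1) <= size v)%N /\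
      forall j, (j < 2 * h + 1)%N ->
      level d v (c + j) = s^-1%g (letterV (level d v (c' + (2 * h - j)))) >])).
    apply: (@walk_freq_reflect R k hk n d (fun a => s^-1%g (letterV a)) c' c).
      exact: ltnW.
    by move=> v /asboolP.
  move=> v y x z y' z' e1 sx e2 sz sy' _; apply/asboolP.
  have [h1 _ h2] := H' v y x z y' z' e1 sx e2 sz sy'; split=> // j jr.
  rewrite h2; last by lia.
  by rewrite letterVK permK; congr (level _ _ _); lia.
have H' v y x z y' z' : v = y ++ x ++ z -> size x = (2 * h + 1)%N ->
    v = y' ++ map s x ++ z' -> size z = c -> size z' = c' ->
  [/\ (c + (2 * h + 1) <= size v)%N, (c' + (2 * h + 1) <= size v)%N &
    forall j, (j < 2 * h + 1)%N -> level d v (c' + j) = s (level d v (c + j))].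
  move=> e1 sx e2 sz sz'; split; first by rewrite e1 !size_cat; lia.
    by rewrite e2 !size_cat size_map; lia.
  move=> j jr; rewrite {1}e2 e1 -sz -sz' level_window ?size_map ?sx //.
  by rewrite level_window ?sx // -map_rev (nth_map d) // size_rev sx.
(* The same walk at two positions, or at the same position up to [s]. *)
have [lt_c|lt_c|ec] := ltngtP c c'.
- apply: (H (fun v => `[< (c' + (2 * h + 1) <= size v)%N /\
      forall j, (j < 2 * h + 1)%N ->
      level d v (c' + j) = s (level d v (c + j)) >])).
    apply: (@walk_freq_translate R k hk n d s c c' (2 * h + 1)) => //.
    by move=> v /asboolP.
  move=> v y x z y' z' e1 sx e2 sz sz' _; apply/asboolP.
  by have [_ h1 h2] := H' v y x z y' z' e1 sx e2 sz sz'.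
- apply: (H (fun v => `[< (c + (2 * h + 1) <= size v)%N /\
      forall j, (j < 2 * h + 1)%N ->
      level d v (c + j) = s^-1%g (level d v (c' + j)) >])).
    apply: (@walk_freq_translate R k hk n d s^-1%g c' c (2 * h + 1)) => //.
    by move=> v /asboolP.
  move=> v y x z y' z' e1 sx e2 sz sz' _; apply/asboolP.
  have [h1 _ h2] := H' v y x z y' z' e1 sx e2 sz sz'; split=> // j jr.
  by rewrite h2 // permK.
have [s1|s1] := eqVneq s 1%g.
  apply: (H (fun _ => false)).
    apply: (@walk_freq_fixed_word R k hk n d (nseq h d) c') => //.
    by rewrite size_nseq.
  move=> v y x z y' z' e1 sx e2 sz sz' []; split=> //.
  have := congr1 size e2; rewrite e1 !size_cat size_map; lia.
apply: (H (fun v => `[< (c + h <= size v)%N /\ forall j, (j < h)%N ->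
    s (level d v (c + j)) = level d v (c + j) >])).
  apply: (@walk_freq_fixed_letters R k hk n d s c h) => //.
  by move=> v /asboolP.
move=> v y x z y' z' e1 sx e2 sz sz' _; apply/asboolP.
have [h1 _ h2] := H' v y x z y' z' e1 sx e2 sz sz'; split; first by lia.
by move=> j jh; rewrite -h2 -?ec //; lia.
Qed.

Definition short_walk n L i (w : walks k p n) : Prop :=
  (flen (walk_ends w i) < L)%N.

Lemma short_walk_prob n L i : walk_prob R (@short_walk n L i) <=
  (7%:R / 8%:R) ^+ n * (L%:R * k%:R ^+ L).
Proof.
apply: (@walk_prob_resample R k p n k0 _ i (fun _ v => size v < L)%N).
  by move=> w t; rewrite /short_walk walk_ends_resample /flen fg_word_walk.
by move=> w; apply: walk_freq_short.
Qed.

Definition unbalanced_walk n L i (a b : letter k) (w : walks k p n) : Prop :=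
  [/\ a != b, (L <= flen (walk_ends w i))%N &
    ((4 * K + 1) * turn2 a b (fg_word (walk_ends w i)) <
      4 * flen (walk_ends w i))%N].

Lemma unbalanced_walk_prob : exists C eta : R,
  [/\ 0 < C, 0 < eta, eta < 1 & forall n L i a b,
    walk_prob R (@unbalanced_walk n L i a b) <=
    n.+1%:R * (C * eta ^+ (L %/ (4 * K + 1)))].
Proof.
have [C [eta [C0 e0 e1 H]]] := few_turns_words R hk.
rewrite -subn1 in H.
exists C, eta; split=> // n L i a b.
pose Q v := [&& a != b, (L <= size v)%N &
  ((4 * K + 1) * turn2 a b v < 4 * size v)%N].
apply: (@walk_prob_resample R k p n k0 _ i (fun _ => Q)).
  move=> w t; rewrite /unbalanced_walk walk_ends_resample /flen fg_word_walk.
  by rewrite /Q => -[-> -> ->].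
move=> _; apply: le_trans (walk_freq_le R n Q k0) _.
rewrite -[n.+1 in leRHS]card_ord mulr_natl -sumr_const; apply: ler_sum => l _.
have q0 : 0 < q%:R ^+ l :> R by rewrite exprn_gt0 // ltr0n; lia.
have r0 : 0 <= C * eta ^+ (L %/ (4 * K + 1)).
  by rewrite mulr_ge0 ?exprn_ge0 ?(ltW C0) ?(ltW e0).
rewrite mulrC ler_pdivrMr //.
have [le_l|lt_l] := leqP L l; last first.
  rewrite big_seq big1; first exact: mulr_ge0 r0 (ltW q0).
  move=> v; rewrite mem_rwords => /andP[_ /eqP sv].
  by rewrite /Q sv (leqNgt L) lt_l /= andbF.
have [eab|nab] := eqVneq a b.
  rewrite big1; first exact: mulr_ge0 r0 (ltW q0).
  by move=> v _; rewrite /Q eab eqxx.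
apply: (@le_trans _ _ (C * (2 * k - 1)%:R ^+ l * eta ^+ (l %/ (4 * K + 1)))).
  apply: le_trans (H l a b nab); rewrite big_seq [leRHS]big_seq.
  apply: ler_sum => v; rewrite mem_rwords => /andP[_ /eqP sv].
  by rewrite /Q sv ler_nat; case: andP => //= -[_ /andP[_ ->]].
rewrite subn1 [leRHS]mulrAC ler_wpM2l ?mulr_ge0 ?(ltW q0) ?(ltW C0) //.
by rewrite ler_wiXn2l ?(ltW e0) ?(ltW e1) // leq_div2r.
Qed.

(** Lower bound on the length of the generators. The factor [14 * k] is such that
    [(7 / 8) ^ (14 * k) * k <= 1 / 2], which makes shorter walks exponentially
    rare. *)
Definition min_length n := (n %/ (14 * k))%N.
(** Repetitions are forbidden for words of length [2 * half_window n + 1], an odd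
    length: a reflection of such a window fixes one letter and exchanges the others
    in pairs. *)
Definition half_window n :=
  (min_length n %/ (3 * (2 * (2 * K + 1) * (4 * K + 1))))%N.

Definition good_walks n (w : walks k p n) : Prop :=
  [/\ 0 < half_window n, small_cancellation (2 * half_window n + 1) (walk_ends w),
      long_generators (2 * half_window n + 1) (walk_ends w) &
      balanced_turns (walk_ends w)]%N.

(** Taking inverses, one may assume that the first generator is a walk itself and not
    its inverse. *)
Lemma small_cancellation_failure n h (w : walks k p n) :
    ~ small_cancellation (2 * h + 1) (walk_ends w) ->
  exists x : {perm letter k} * 'I_p * 'I_p * bool * 'I_n.+1 * 'I_n.+1,
    cancellation_fails h x.1.1.1.1.1 x.1.1.1.1.2 x.1.1.1.2 x.1.1.2 x.1.2 x.2 w.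
Proof.
move=> nsc; apply: contrapT => H; apply: nsc.
have size_le c : (size (gen_word (walk_ends w) c) <= n)%N.
  rewrite size_gen_word (leq_trans (flen_ev _)) //.
  by rewrite size_tuple.
have pos s i d y x z y' z' : signed_perm s ->
    gen_word (walk_ends w) (i, true) = y ++ x ++ z -> size x = (2 * h + 1)%N ->
    gen_word (walk_ends w) d = y' ++ map s x ++ z' ->
  [/\ s = 1%g, (i, true) = d & size y = size y'].
  move=> sV e1 sx e2; apply: contrapT => ns; apply: H.
  have lz : (size z < n.+1)%N.
    by have := size_le (i, true); rewrite e1 !size_cat; lia.
  case: d e2 ns => j e e2 ns.
  have lc' : ((if e then size z' else size y') < n.+1)%N.
    by have := size_le (j, e); rewrite e2 !size_cat; case: (e); lia.
  exists (s, i, j, e, Ordinal lz, Ordinal lc'); split=> //.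
  by exists y, x, z, y', z'.
move=> s [i []] d y x z y' z' sV e1 sx e2; first exact: pos e1 sx e2.
have [|||es ed esz] := @pos s i (letterV d) (word_inv z) (word_inv x)
  (word_inv y) (word_inv z') (word_inv y') sV.
- by rewrite (gen_wordV _ (i, false)) e1 !word_inv_cat catA.
- by rewrite size_word_inv.
- rewrite gen_wordV e2 !word_inv_cat -catA; congr (_ ++ _ ++ _).
  rewrite /word_inv map_rev -!map_comp; congr (rev _); apply: eq_map => a /=.
  by rewrite sV.
split=> //; first by rewrite -[RHS]letterVK -ed.
rewrite !size_word_inv in esz; have ed' : d = (i, false).
  by rewrite -[LHS]letterVK -ed.
have := congr1 size e2; rewrite ed' e1 !size_cat size_map; lia.
Qed.

Lemma short_rate_le n : (7%:R / 8%:R : R) ^+ n *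
    ((min_length n)%:R * k%:R ^+ min_length n) <=
  (min_length n).+1%:R * 2^-1 ^+ min_length n.
Proof.
set L := min_length n; set B : R := (7%:R / 8%:R) ^+ (14 * k).
have B0 : 0 <= B by apply: exprn_ge0; lra.
have le_B : (7%:R / 8%:R : R) ^+ n <= B ^+ L.
  rewrite -exprM; apply: ler_wiXn2l; [lra | lra |].
  by rewrite mulnC leq_divM.
have Bk : B * k%:R <= 2^-1.
  have := @bernoulli R 7%:R^-1 (14 * k); move=> /(_ ltac:(lra)) h.
  have e : B * (1 + 7%:R^-1) ^+ (14 * k) = 1.
    by rewrite /B -exprMn (_ : _ * _ = 1) ?expr1n //; lra.
  by have := ler_wpM2l B0 h; rewrite e natrM; lra.
apply: (@le_trans _ _ (L%:R * (B * k%:R) ^+ L)).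
  by rewrite mulrCA ler_wpM2l // [(B * _) ^+ _]exprMn ler_wpM2r ?exprn_ge0.
apply: ler_pM => //; rewrite ?exprn_ge0 ?mulr_ge0 // ?ler_nat //.
by apply: lerXn2r; rewrite ?nnegrE ?mulr_ge0 //; lra.
Qed.

Lemma good_walks_generic :
  exp_small (fun n => walk_prob R (~` (@good_walks n))%classic).
Proof.
have [C [eta [C0 e0 e1 hU]]] := unbalanced_walk_prob.
pose D := (3 * (2 * (2 * K + 1) * (4 * K + 1)))%N.
have D0 : (0 < D)%N by rewrite /D !muln_gt0 !addn1.
pose u1 n : R := p%:R * ((7%:R / 8%:R) ^+ n *
  ((min_length n)%:R * k%:R ^+ min_length n)).
pose u2 n : R := #|{: 'I_p * letter k * letter k}|%:R *
  (n.+1%:R * (C * eta ^+ (min_length n %/ (4 * K + 1)))).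
pose u3 n : R := #|{: {perm letter k} * 'I_p * 'I_p * bool}|%:R *
  (n.+1%:R * (n.+1%:R * (n.+1%:R * (2 * phi ^+ half_window n)))).
apply: (@exp_small_eventually R (14 * k * D) _ (fun n => u1 n + (u2 n + u3 n))).
- by move=> n; apply: walk_prob_le1.
- move=> n le_n; set L := min_length n; set h := half_window n.
  have h0 : (0 < h)%N.
    rewrite /h /half_window -/D divn_gt0 // /min_length leq_divRL ?muln_gt0 //.
    by rewrite mulnC.
  have hL : ((2 * h + 1) * (2 * (2 * K + 1) * (4 * K + 1)) <= L)%N.
    apply: (@leq_trans (h * D)); last exact: leq_divM.
    by rewrite /D [leqRHS]mulnA leq_mul2r; apply/orP; right; lia.
  apply: (@le_trans _ _ (walk_prob R [set w : walks k p n |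
      (exists i, short_walk L i w) \/
      ((exists x : 'I_p * letter k * letter k,
          unbalanced_walk L x.1.1 x.1.2 x.2 w) \/
       exists x : {perm letter k} * 'I_p * 'I_p * bool * 'I_n.+1 * 'I_n.+1,
    cancellation_fails h x.1.1.1.1.1 x.1.1.1.1.2 x.1.1.1.2 x.1.1.2 x.1.2 x.2 w)])).
    apply: walk_prob_le => // w ngood; apply: contrapT => nbad; apply: ngood.
    have long i : (L <= flen (walk_ends w i))%N.
      by rewrite leqNgt; apply/negP => lt; apply: nbad; left; exists i.
    split=> //.
    + apply: contrapT => nsc; apply: nbad; right; right.
      exact: small_cancellation_failure.
    + by move=> i; apply: leq_trans (long i).
    + move=> i a b ab; rewrite leqNgt; apply/negP => lt; apply: nbad.
      by right; left; exists (i, a, b).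
  apply: le_trans (walk_probU _ _ _) _ => //; apply: lerD.
    have -> : u1 n = #|'I_p|%:R * ((7%:R / 8%:R) ^+ n * (L%:R * k%:R ^+ L)).
      by rewrite card_ord.
    apply: walk_prob_exists => // i.
    exact: short_walk_prob.
  apply: le_trans (walk_probU _ _ _) _ => //; apply: lerD.
    by apply: walk_prob_exists => // -[[i a] b]; apply: hU.
  have -> : u3 n = #|{: {perm letter k} * 'I_p * 'I_p * bool * 'I_n.+1 *
      'I_n.+1}|%:R * (n.+1%:R * (2 * phi ^+ h)).
    rewrite /u3 (card_prod (_ * 'I_n.+1)%type) (card_prod (_ * bool)%type 'I_n.+1).
    by rewrite !card_ord !natrM; lra.
  by apply: walk_prob_exists => // -[[[[[s i] j] e] c] c']; apply: cancellation_fails_prob.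
apply: exp_smallD.
  apply: exp_smallZ => //.
  apply: (@exp_small_le _ _ (fun n => (min_length n).+1%:R * (1 * 2^-1 ^+ min_length n))).
    by move=> n; rewrite mul1r; apply: short_rate_le.
  apply: (@exp_small_divn _ (14 * k) (fun m => m.+1%:R * (1 * 2^-1 ^+ m))).
    by rewrite muln_gt0.
  by apply/exp_small_mulSn/exp_small_geom; lra.
apply: exp_smallD; apply: exp_smallZ => //; apply: exp_small_mulSn.
  apply: (@exp_small_divn _ (14 * k) (fun m => C * eta ^+ (m %/ (4 * K + 1)))).
    by rewrite muln_gt0.
  apply: (@exp_small_divn _ (4 * K + 1) (fun m => C * eta ^+ m)).
    by rewrite addn1.
  by apply: exp_small_geom => //; apply: ltW.
do 2!apply: exp_small_mulSn.
apply: (@exp_small_divn _ (14 * k) (fun m => 2 * phi ^+ (m %/ D))).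
  by rewrite muln_gt0.
apply: (@exp_small_divn _ D (fun m => 2 * phi ^+ m)) => //.
have q1 : 1 < q%:R :> R by rewrite ltr1n; lia.
apply: exp_small_geom; first by rewrite divr_ge0; lra.
by rewrite ltr_pdivrMr; lra.
Qed.

End Genericity.

Theorem theorem1p3 (R : realType) (k p : nat) (hk : (2 <= k)%N) (hp : (1 <= p)%N) :
  exp_generic R (fun n (s : walks k p n) => Aut_malnormal (walk_subgroup s)) /\
  exp_generic R (fun n (s : walks k p n) =>
    Aut_stab (walk_subgroup s) = Inn_by (walk_subgroup s)).
Proof.
have k0 : (0 < k)%N by apply: leq_trans hk.
have small (E : forall n, set (walks k p n)) :
    (forall n s, good_walks s -> E n s) -> exp_generic R E.
  move=> goodE; apply: exp_generic_small.
  apply: exp_small_le (good_walks_generic R p hk) => n.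
  by apply: walk_prob_le => // s nEs good; apply: nEs; apply: goodE.
have malnormal n (s : walks k p n) : good_walks s ->
    Aut_malnormal (walk_subgroup s).
  move=> [h0 sc long bal].
  by apply: (gen_subgroup_malnormal hk _ sc long bal); rewrite addn1.
split; apply: small => n s good; first exact: malnormal.
apply: Aut_stab_malnormal; last exact: malnormal.
- have [H1 HM HV] := subgroup_gen_closed
    [set word_eval (@fg_basis k) (s i) | i in [set: 'I_p]]%classic.
  by apply/group_closedP; split=> // x y Hx Hy; apply: HM => //; apply: HV.
- case: good => h0 sc long bal.
  by apply: (gen_subgroup_nontrivial hk _ long (Ordinal hp)); rewrite addn1.
Qed.
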